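(* Let $k\ge2$ and let $\mathcal H$ be an $(\alpha,c,D,\nu,\delta)$-family of functions $h:\mathbb{N}^k\to[0,\infty)$. For $h\in\mathcal H$ and $N\ge1$ let $\Upsilon(N)=\sum_{\mathbf{u}\in\mathbb{N}^k,\ u_1u_2\cdots u_k\le N}h(\mathbf{u})$. Then there exists $\eta>0$ such that for every $h\in\mathcal H$ there is a polynomial $P_h\in\mathbb{R}[x]$ of degree at most $k-2$ with $$\Upsilon(N)=N^\alpha\Big(\frac{c_h\alpha^{k-1}}{(k-1)!}(\log N)^{k-1}+P_h(\log N)\Big)+O(N^{\alpha-\eta}),$$ where the implied constant does not depend on $h\in\mathcal H$ or $N>1$.
   Context: Notation: for $\mathbf{x},\mathbf{X}\in\mathbb{R}^k$, $\mathbf{x}\le\mathbf{X}$ means $x_j\le X_j$ for all $j$; for $\mathbf{X}$ with all $X_j\ge1$, $\langle\mathbf{X}\rangle=X_1\cdots X_k$; $|\mathbf{u}|=\max_j|u_j|$; for $\mathbf{u}\in\mathbb{N}^r$, $\mathbf{v}\in\mathbb{N}^{k-r}$, $(\mathbf{u},\mathbf{v})\in\mathbb{N}^k$ is the concatenation; for $\sigma\in S_k$, $h_\sigma(\mathbf{x})=h(x_{\sigma(1)},\ldots,x_{\sigma(k)})$. Let $\alpha,c,\delta>0$ with $\delta<\min(1,\alpha)$, $0<\nu\le1$, $D\ge0$. A set $\mathcal H$ of functions $h:\mathbb{N}^k\to[0,\infty)$ is an $(\alpha,c,D,\nu,\delta)$-family if: (I) for each $h\in\mathcal H$ there is $c_h\in[0,c]$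 with $\sum_{\mathbf{x}\le\mathbf{X}}h(\mathbf{x})=c_h\langle\mathbf{X}\rangle^\alpha+O(\langle\mathbf{X}\rangle^\alpha(\min_jX_j)^{-\delta})$ uniformly in $h\in\mathcal H$ and $\mathbf{X}\in[1,\infty)^k$; (II) for each $h\in\mathcal H$ and each $1\le r\le k-1$ there is $c_{h,r}:\mathbb{N}^r\to[0,\infty)$ with $\sum_{\mathbf{v}\le\mathbf{V}}h(\mathbf{u},\mathbf{v})=c_{h,r}(\mathbf{u})\langle\mathbf{V}\rangle^\alpha+O(\langle\mathbf{V}\rangle^\alpha|\mathbf{u}|^D(\min_jV_j)^{-\delta})$ uniformly in $h\in\mathcal H$, $\mathbf{V}\in[1,\infty)^{k-r}$ and $\mathbf{u}\in\mathbb{N}^r$ with $|\mathbf{u}|\le\langle\mathbf{V}\rangle^\nu$ (sum over $\mathbf{v}\in\mathbb{N}^{k-r}$); (III) $h_\sigma\in\mathcal H$ for all $h\in\mathcal H$, $\sigma\in S_k$. *)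

(* Defs.v *)
From HB Require Import structures.
From mathcomp Require Import all_boot all_order all_algebra.
From mathcomp Require Import perm.
From mathcomp Require Import all_classical all_reals all_analysis.

Set Implicit Arguments.
Unset Strict Implicit.
Unset Printing Implicit Defensive.

Import Order.TTheory GRing.Theory Num.Theory.

Local Open Scope classical_set_scope.
Local Open Scope ring_scope.

(* The set N = {1, 2, 3, ...}; elements of N^k are row vectors 'rV[posnat]_k. *)
Definition posnat := {n : nat | (0 < n)%N}.

Section Family.
Context {R : realType}.

Definition ge1_vec k (X : 'rV[R]_k) := forall j, 1 <= X ord0 j.

Definition vprod k (X : 'rV[R]_k) : R := \prod_(j < k) X ord0 j.

(* For k > 0 the infimum is over a nonempty finite set, hence a minimum. *)
Definition vmin k (X : 'rV[R]_k) : R := inf (range (fun j : 'I_k => X ord0 j)).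

Definition maxnorm k (u : 'rV[posnat]_k) : nat := \max_(j < k) val (u ord0 j).

(* This set and [hyperbolic N] below are finite, so the finitely supported
   sums \sum_(x \in A) over them are ordinary finite sums. *)
Definition box k (X : 'rV[R]_k) : set 'rV[posnat]_k :=
  [set x | forall j, (val (x ord0 j))%:R <= X ord0 j].

Definition hyperbolic k (N : R) : set 'rV[posnat]_k :=
  [set u | (\prod_(j < k) val (u ord0 j))%:R <= N].

Definition Upsilon k (h : 'rV[posnat]_k -> R) (N : R) : R :=
  \sum_(u \in hyperbolic N) h u.

Definition concat k r s (e : (r + s)%N = k)
    (u : 'rV[posnat]_r) (v : 'rV[posnat]_s) : 'rV[posnat]_k :=
  castmx (erefl 1%N, e) (row_mx u v).

(* [col_perm sigma x] has j-th coordinate x_(sigma j). *)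
Definition hperm k (sigma : 'S_k) (h : 'rV[posnat]_k -> R) :
    'rV[posnat]_k -> R :=
  fun x => h (col_perm sigma x).

(* Condition (I) determines the coefficient c_h uniquely for each h in H; the
   function [ch] is the assignment h |-> c_h. In (II), s stands for k - r. *)
Record is_family k (alpha c D nu delta : R) (H : set ('rV[posnat]_k -> R))
    (ch : ('rV[posnat]_k -> R) -> R) : Prop := IsFamily {
  family_ge0 : forall h, H h -> forall x, 0 <= h x;
  family_ch : forall h, H h -> 0 <= ch h <= c;
  family_I : exists C : R, forall h, H h ->
    forall X : 'rV[R]_k, ge1_vec X ->
    `| \sum_(x \in box X) h x - ch h * vprod X `^ alpha |
      <= C * (vprod X `^ alpha * vmin X `^ (- delta));
  family_II : forall (r s : nat) (e : (r + s)%N = k), (0 < r)%N -> (0 < s)%N ->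
    exists C : R, forall h, H h ->
    exists2 chr : 'rV[posnat]_r -> R, (forall u, 0 <= chr u) &
    forall (V : 'rV[R]_s) (u : 'rV[posnat]_r), ge1_vec V ->
    (maxnorm u)%:R <= vprod V `^ nu ->
    `| \sum_(v \in box V) h (concat e u v) - chr u * vprod V `^ alpha |
      <= C * (vprod V `^ alpha * (maxnorm u)%:R `^ D * vmin V `^ (- delta));
  family_III : forall h (sigma : 'S_k), H h -> H (hperm sigma h)
}.

End Family.

(* Main.v *)
Require Import Defs.
From HB Require Import structures.
From mathcomp Require Import all_boot all_order all_algebra.
From mathcomp Require Import perm.
From mathcomp Require Import all_classical all_reals all_analysis.
From mathcomp Require Import ring lra zify.

(* Idea. Put U(L) = Upsilon(e^L) and cut N^k into the cells of a geometric grid of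
   ratio e^w. In each direction the main terms of (I) and (II) are killed by the
   operator 1 - e^(alpha w) S, S being the shift by one grid step. Splitting the
   sorted coordinates at a multiplicative gap, and using (II) with the small ones
   as u, shows that this operator in the direction of the largest coordinate maps
   the box sums F(X) to O(<X>^alpha max(X)^(-eta)). Let T(M) be the sum of h over
   the cells of index sum at most M. A generating function identity expresses
   (1 - e^(alpha w) S)^k T through the images of the box sums of index sum M under
   the operators in all k directions, so e^(-alpha w M) T(M) has k-th difference
   O(e^(-eta w M)), up to powers of M. By Newton's formula it is then close to a
   polynomial in M of degree at most k - 1 on long windows. As
   T(M) <= U(w M) <= T(M + k), letting w decrease exponentially in L gives
   polynomials approximating e^(-alpha L) U(L) on overlapping windows with
   exponentially small error. Their coefficients form Cauchy sequences, and the
   limit is the required polynomial; its leading coefficient is read off from a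
   telescoping sum over a cube, evaluated by (I). *)

Set Implicit Arguments.
Unset Strict Implicit.
Unset Printing Implicit Defensive.

Import Order.TTheory GRing.Theory Num.Theory.

Local Open Scope classical_set_scope.
Local Open Scope ring_scope.

(** * Sums over boxes *)

(** Nothing is assumed on the size of the coefficients c_(h,r)(u) in (II), and the error term of (I)
    saves nothing when one coordinate is bounded. So main terms cannot be summed over the hyperbolic
    region: they have to cancel exactly, and every estimate is made on differences. The identity
    behind this: let F(z) be the sum over n of z^|n| times the box sum at n, |n| being the index
    sum. The cell sums have the series (1 - z)^k F, and their partial sums T the series (1 -
    z)^(k-1) F, as one factor is spent on the summation. With t = e^(alpha w) this gives (1 - t z)^k
    T = (1 - z)^(k-1) (1 - t z)^k F, where (1 - t z)^k F collects the differences taken in all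
    directions. The factors 1 - z only cost 2^(k-1). The mesh w cannot stay fixed, since T(M) <= U(w
    M) <= T(M + k) loses a relative error of order w. It cannot shrink too fast either: Newton's
    formula on a window of length L loses powers of L / w, and the leading coefficient a further
    w^-(k-1). *)

Definition pos_of_ord (B : nat) (i : 'I_B) : posnat :=
  exist (fun n => (0 < n)%N) i.+1 (ltn0Sn i).

(** A common finite list of indices: sums over boxes and hyperbolic regions become filtered sums
    over it, to which the lemmas on ordinary sums apply. *)
Definition cube (k B : nat) : seq 'rV[posnat]_k :=
  [seq map_mx (@pos_of_ord B) x | x <- enum {: 'rV['I_B]_k}].

Lemma cube_uniq k B : uniq (cube k B).
Proof.
rewrite map_inj_uniq ?enum_uniq// => x y /matrixP xy; apply/matrixP => i j.
by have := xy i j; rewrite !mxE => -[] /val_inj.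
Qed.

Lemma size_cube k B : size (cube k B) = (B ^ k)%N.
Proof. by rewrite size_map -cardE card_mx card_ord mul1n. Qed.

Lemma mem_cube k B (x : 'rV[posnat]_k) :
  (forall j, (val (x ord0 j) <= B)%N) -> x \in cube k B.
Proof.
move=> xB; have lt j : ((val (x ord0 j)).-1 < B)%N.
  by rewrite prednK ?xB//; exact: (valP (x ord0 j)).
apply/mapP; exists (\row_j Ordinal (lt j)); first by rewrite mem_enum.
apply/matrixP => i j; rewrite !mxE (ord1 i); apply/val_inj => /=.
by rewrite prednK//; exact: (valP (x ord0 j)).
Qed.

Lemma fsum_seq {V : nmodType} {T : choiceType} (A : set T) (s : seq T)
    (f : T -> V) : uniq s -> A `<=` [set` s] ->
  \sum_(x \in A) f x = \sum_(x <- s | x \in A) f x.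
Proof.
move=> us As; rewrite [RHS]bigfs//; last first.
  by move=> x; rewrite inE => /As /= ->.
by apply: eq_fsbigl; apply/seteqP; split=> x /=; rewrite inE.
Qed.

Section BoxSums.
Context {R : realType}.

Lemma box_sub_cube k (X : 'rV[R]_k) B :
  (forall j, X ord0 j <= B%:R) -> box X `<=` [set` cube k B].
Proof.
move=> XB x xX /=; apply: mem_cube => j.
by rewrite -(ler_nat R); apply: le_trans (XB j).
Qed.

Lemma row_bounded k (X : 'rV[R]_k) : exists B : nat, forall j, X ord0 j <= B%:R.
Proof.
exists (\max_j (Num.truncn (X ord0 j)).+1)%N => j.
by rewrite (le_trans (ltW (truncnS_gt _)))// ler_nat; exact: leq_bigmax.
Qed.

Lemma finite_box k (X : 'rV[R]_k) : finite_set (box X).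
Proof.
have [B XB] := row_bounded X.
exact: sub_finite_set (box_sub_cube XB) (finite_seq _).
Qed.

Lemma sum_box_ge0 k (h : 'rV[posnat]_k -> R) (X : 'rV[R]_k) :
  (forall x, 0 <= h x) ->
  0 <= \sum_(x \in box X) h x.
Proof. by move=> h0; apply: sumr_ge0. Qed.

Lemma sum_box_norm_le k (f : 'rV[posnat]_k -> R) (X : 'rV[R]_k) m e : 0 <= m -> 0 <= e ->
  (forall j, X ord0 j <= m) -> (forall x, box X x -> `|f x| <= e) ->
  `|\sum_(x \in box X) f x| <= m ^+ k * e.
Proof.
move=> m0 e0 Xm fe; set B := Num.truncn m.
have Bm : B%:R <= m by rewrite truncn_le.
have sub : box X `<=` [set` cube k B].
  move=> x xX /=; apply: mem_cube => j.
  by rewrite truncn_ge_nat//; apply: le_trans (Xm j).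
rewrite (fsum_seq _ (cube_uniq k B) sub).
apply: le_trans (ler_norm_sum _ _ _) _.
apply: (@le_trans _ _ (\sum_(x <- cube k B) e)).
  rewrite [leLHS]big_mkcond; apply: ler_sum => x _.
  by case: ifP => //; rewrite inE => /fe.
rewrite big_const_seq count_predT iter_addr_0 size_cube -[leLHS]mulr_natl natrX.
by rewrite ler_wpM2r// lerXn2r// nnegrE.
Qed.

Lemma sum_box_hperm k (h : 'rV[posnat]_k -> R) (sigma : 'S_k) (X : 'rV[R]_k) :
  \sum_(x \in box X) hperm sigma h x =
  \sum_(x \in box (col_perm sigma X)) h x.
Proof.
symmetry; apply: (reindex_fsbig (col_perm sigma)); split.
- by move=> x xX j; rewrite !mxE; exact: xX.
- move=> x y _ _ /matrixP xy; apply/matrixP => i j.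
  by have := xy i (sigma^-1%g j); rewrite !mxE permKV.
- move=> y yX; exists (col_perm sigma^-1 y).
    by move=> j; have := yX (sigma^-1%g j); rewrite !mxE permKV.
  by apply/matrixP => i j; rewrite !mxE permK.
Qed.

Lemma sum_box_concat k r s (e : (r + s)%N = k) (h : 'rV[posnat]_k -> R)
    (U : 'rV[R]_r) (V : 'rV[R]_s) :
  \sum_(x \in box (castmx (erefl 1%N, e) (row_mx U V))) h x =
  \sum_(u \in box U) \sum_(v \in box V) h (concat e u v).
Proof.
case: k / e h => h; rewrite castmx_id pair_fsbig; [|exact: finite_box..].
apply: (reindex_fsbig (fun p => concat erefl p.1 p.2)); split.
- move=> [u v] [/= uU vV] j; rewrite /concat castmx_id.
  by rewrite !mxE; case: splitP => i _; [exact: uU|exact: vV].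
- move=> [u v] [u' v'] _ _ /=; rewrite /concat !castmx_id.
  by move=> /eq_row_mx[-> ->].
- move=> x xX; exists (lsubmx x, rsubmx x).
    split=> j /=; rewrite mxE.
      by have := xX (lshift s j); rewrite row_mxEl.
    by have := xX (rshift r j); rewrite row_mxEr.
  by rewrite /concat castmx_id hsubmxK.
Qed.

End BoxSums.

(** * Differences of box sums in one coordinate *)

Section PowerBounds.
Context {R : realType}.
Implicit Types x y a m : R.

Lemma powR_ge1 x a : 1 <= x -> 0 <= a -> 1 <= x `^ a.
Proof. by move=> x1 a0; rewrite -(powRr0 x) ler_powR. Qed.

Lemma powR_lel x y a : 0 <= a -> 0 <= x -> x <= y -> x `^ a <= y `^ a.
Proof.
by move=> a0 x0 xy; apply: ge0_ler_powR; rewrite ?nnegrE// (le_trans x0).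
Qed.

Lemma powRN_lel x y a : 0 <= a -> 0 < x -> x <= y -> y `^ (- a) <= x `^ (- a).
Proof.
move=> a0 x0 xy; rewrite !powRN lef_pV2 ?posrE ?powR_gt0//.
  by apply: powR_lel => //; exact: ltW.
exact: lt_le_trans xy.
Qed.

End PowerBounds.

Section Vectors.
Context {R : realType}.

Lemma prodr_ge1 (I : finType) (P : pred I) (F : I -> R) :
  (forall i, P i -> 1 <= F i) -> 1 <= \prod_(i | P i) F i.
Proof. by move=> F1; elim/big_ind: _ => // x y; exact: mulr_ege1. Qed.

Lemma vprod_ge1 k (X : 'rV[R]_k) : ge1_vec X -> 1 <= vprod X.
Proof. by move=> X1; apply: prodr_ge1 => j _; exact: X1. Qed.

Lemma vprod_ge k (X : 'rV[R]_k) j : ge1_vec X -> X ord0 j <= vprod X.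
Proof.
move=> X1; rewrite /vprod (bigD1 j)//= ler_peMr ?(le_trans ler01)//.
by apply: prodr_ge1 => i _; exact: X1.
Qed.

Lemma vmin_ge k (X : 'rV[R]_k.+1) m :
  (forall j, m <= X ord0 j) -> m <= vmin X.
Proof.
move=> mX; apply: lb_le_inf; first by exists (X ord0 ord0), ord0.
by move=> _ [j _ <-].
Qed.

Lemma vprod_concat k r s (e : (r + s)%N = k) (U : 'rV[R]_r) (V : 'rV[R]_s) :
  vprod (castmx (erefl 1%N, e) (row_mx U V)) = vprod U * vprod V.
Proof.
case: k / e; rewrite castmx_id /vprod big_split_ord.
by congr (_ * _); apply: eq_bigr => j _; rewrite ?row_mxEl ?row_mxEr.
Qed.

Lemma maxnorm_le r (u : 'rV[posnat]_r) (U : 'rV[R]_r) m : 0 <= m ->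
  (forall j, U ord0 j <= m) -> box U u -> (maxnorm u)%:R <= m.
Proof.
move=> m0 Um uU; rewrite -truncn_ge_nat//; apply/bigmax_leqP => j _.
by rewrite truncn_ge_nat//; apply: le_trans (Um j).
Qed.

(** For [mu = expR w] this is the shift by one grid step in the last direction. The estimates of
    this part hold for real vectors, with no grid fixed yet. *)
Definition divlast n (X : 'rV[R]_n.+1) (mu : R) : 'rV[R]_n.+1 :=
  \row_j (if j == ord_max then X ord0 j / mu else X ord0 j).

Lemma vprod_divlast n (X : 'rV[R]_n.+1) mu :
  vprod (divlast X mu) = vprod X / mu.
Proof.
rewrite /vprod.
rewrite (eq_bigr (fun j => X ord0 j * (if j == ord_max then mu^-1 else 1))).
  by rewrite big_split /= -big_mkcond big_pred1_eq.
by move=> j _; rewrite mxE; case: ifP => _; rewrite ?mulr1.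
Qed.

Lemma divlast_concat n r s (e : (r + s.+1)%N = n.+1) (U : 'rV[R]_r)
    (V : 'rV[R]_s.+1) mu :
  divlast (castmx (erefl 1%N, e) (row_mx U V)) mu =
  castmx (erefl 1%N, e) (row_mx U (divlast V mu)).
Proof.
apply/rowP => j; rewrite mxE !castmxE !(ord1 (cast_ord _ _)) !mxE.
case: splitP => i /= ji; rewrite ?mxE -val_eqE /= ji.
  by case: eqP => // iE; have := ltn_ord i; lia.
by rewrite -[i == ord_max]val_eqE /=; congr (if _ then _ else _); apply/eqP/eqP; lia.
Qed.

Lemma divlast_ge n (X : 'rV[R]_n.+1) mu m : 1 <= mu ->
  (forall j, 0 < X ord0 j) ->
  (forall j, m <= X ord0 j) -> forall j, m / mu <= divlast X mu ord0 j.
Proof.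
move=> mu1 X0 mX j; have mu0 : 0 < mu := lt_le_trans ltr01 mu1.
rewrite mxE; case: ifP => _; rewrite ler_pdivrMr// ?divfK ?gt_eqF//.
by rewrite (le_trans (mX j))// ler_peMr// ltW.
Qed.

Lemma divlast_ge1 n (X : 'rV[R]_n.+1) mu : 1 <= mu -> mu <= X ord0 ord_max ->
  ge1_vec X -> ge1_vec (divlast X mu).
Proof.
move=> mu1 muX X1 j; rewrite mxE; case: ifP => // /eqP ->.
by rewrite ler_pdivlMr ?mul1r// (lt_le_trans ltr01 mu1).
Qed.

End Vectors.

Lemma sum_box_sub {R : realType} k (f g : 'rV[posnat]_k -> R) (X : 'rV[R]_k) a :
  \sum_(x \in box X) f x - a * \sum_(x \in box X) g x =
  \sum_(x \in box X) (f x - a * g x).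
Proof.
have [B XB] := row_bounded X; rewrite mulr_fsumr.
by rewrite !(fsum_seq _ (cube_uniq k B) (box_sub_cube XB)) -sumrB.
Qed.

Section Differences.
Context {R : realType} {k : nat} {alpha c D nu delta : R}.
Context {H : set ('rV[posnat]_k.+1 -> R)} {ch : ('rV[posnat]_k.+1 -> R) -> R}.
Context (delta0 : 0 < delta) (nu0 : 0 < nu) (D0 : 0 <= D).
Context (fam : is_family alpha c D nu delta H ch).

Let e1 : R := expR 1.
Let e1_ge1 : 1 <= e1. Proof. by apply: le_trans (expR_ge1Dx 1); rewrite lerDl. Qed.
Let e1_gt0 : 0 < e1. Proof. exact: expR_gt0. Qed.

Lemma powR_divlast n (V : 'rV[R]_n.+1) mu : 1 <= mu -> ge1_vec V ->
  mu `^ alpha * vprod (divlast V mu) `^ alpha = vprod V `^ alpha.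
Proof.
move=> mu1 V1; have mu0 : 0 < mu := lt_le_trans ltr01 mu1.
have v1 := vprod_ge1 V1.
rewrite -powRM ?(ltW mu0) ?vprod_divlast ?divr_ge0 ?(ltW mu0)//; last first.
  by rewrite (le_trans ler01).
by rewrite mulrC divfK// gt_eqF.
Qed.

Lemma vmin_divlast n (V : 'rV[R]_n.+1) mu m : 1 <= mu <= e1 -> 0 < m ->
  (forall j, m <= V ord0 j) ->
  vmin (divlast V mu) `^ (- delta) <= e1 `^ delta * m `^ (- delta).
Proof.
move=> /andP[mu1 mue] m0 mV; have mu0 : 0 < mu := lt_le_trans ltr01 mu1.
have V0 j : 0 < V ord0 j by exact: lt_le_trans (mV j).
have mge : m / e1 <= vmin (divlast V mu).
  apply: vmin_ge => j; apply: le_trans (divlast_ge mu1 V0 mV j).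
  by rewrite ler_pM2l// lef_pV2 ?posrE.
apply: (le_trans (powRN_lel (ltW delta0) _ mge)); first exact: divr_gt0.
rewrite powRM ?invr_ge0 ?(ltW m0) ?(ltW e1_gt0)// mulrC.
by rewrite -(powR_inv1 (ltW e1_gt0)) -powRrM mulN1r opprK.
Qed.

(** The factor e1^delta matches the bound in [vmin_divlast], so that the shifted and the unshifted
    error term are treated alike. *)
Lemma vmin_bound n (V : 'rV[R]_n.+1) m : 0 < m ->
  (forall j, m <= V ord0 j) ->
  vmin V `^ (- delta) <= e1 `^ delta * m `^ (- delta).
Proof.
move=> m0 mV; apply: (@le_trans _ _ (m `^ (- delta))).
  by apply: powRN_lel (ltW delta0) m0 _; exact: vmin_ge.
by rewrite ler_peMl ?powR_ge0// powR_ge1// ltW.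
Qed.

(* The main term of (I), and below that of (II), is homogeneous of degree [alpha]
   in the last coordinate, so it cancels from the left-hand side. *)
Lemma diff_I : exists2 C, 0 <= C & forall h, H h ->
  forall (V : 'rV[R]_k.+1) mu m, 0 < m -> ge1_vec V ->
  1 <= mu <= e1 -> mu <= V ord0 ord_max ->
  (forall j, m <= V ord0 j) ->
  `|\sum_(x \in box V) h x - mu `^ alpha * \sum_(x \in box (divlast V mu)) h x|
  <= C * (vprod V `^ alpha * m `^ (- delta)).
Proof.
have [C0 CP] := family_I fam; exists (2 * `|C0| * e1 `^ delta).
  by rewrite !mulr_ge0 ?powR_ge0.
move=> h Hh V mu m m0 V1 mue muV mV; have /andP[mu1 mue1] := mue.
have V'1 := divlast_ge1 mu1 muV V1.
have := CP h Hh V V1; have := CP h Hh _ V'1.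
set S' := \sum_(x \in _) _; set S := \sum_(x \in _) _ => h1 h2.
have -> : S - mu `^ alpha * S' = (S - ch h * vprod V `^ alpha)
  - mu `^ alpha * (S' - ch h * vprod (divlast V mu) `^ alpha).
  by rewrite -(powR_divlast mu1 V1); ring.
apply: le_trans (ler_normB _ _) _; rewrite normrM (ger0_norm (powR_ge0 _ _)).
have vd := powR_divlast mu1 V1.
have b1 : C0 * (vprod V `^ alpha * vmin V `^ (- delta)) <=
  `|C0| * (vprod V `^ alpha * (e1 `^ delta * m `^ (- delta))).
  apply: (@le_trans _ _ (`|C0| * (vprod V `^ alpha * vmin V `^ (- delta)))).
    by rewrite ler_wpM2r ?ler_norm// mulr_ge0 ?powR_ge0.
  by rewrite ler_wpM2l// ler_wpM2l ?powR_ge0//; exact: vmin_bound.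
have b2 : mu `^ alpha * (C0 * (vprod (divlast V mu) `^ alpha * vmin (divlast V mu) `^ (- delta))) <=
  `|C0| * (vprod V `^ alpha * (e1 `^ delta * m `^ (- delta))).
  rewrite mulrCA [X in C0 * X]mulrA vd.
  apply: (@le_trans _ _ (`|C0| * (vprod V `^ alpha * vmin (divlast V mu) `^ (- delta)))).
    by rewrite ler_wpM2r ?ler_norm// mulr_ge0 ?powR_ge0.
  by rewrite ler_wpM2l// ler_wpM2l ?powR_ge0//; exact: vmin_divlast.
have := le_trans h2 b1.
have := le_trans (ler_wpM2l (powR_ge0 mu alpha) h1) b2.
lra.
Qed.

(** For each fixed [u] the main terms at [V] and at the shifted [V] cancel. At most m^(eps r)
    vectors [u] remain, each with a factor |u|^D <= m^(eps D), and [eps * (r%:R + D) <= delta / 2]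
    pays for both with half of the saving. *)
Lemma diff_II r s (e : (r + s.+1)%N = k.+1) eps : (0 < r)%N ->
  0 < eps -> eps <= nu / 2 -> eps * (r%:R + D) <= delta / 2 ->
  exists2 C, 0 <= C & forall h, H h ->
  forall (U : 'rV[R]_r) (V : 'rV[R]_s.+1) mu m, 1 <= m ->
  ge1_vec V -> 1 <= mu <= e1 -> e1 ^+ 2 <= V ord0 ord_max ->
  (forall j, m <= V ord0 j) -> (forall j, U ord0 j <= m `^ eps) ->
  `|\sum_(u \in box U) \sum_(v \in box V) h (concat e u v)
    - mu `^ alpha *
      \sum_(u \in box U) \sum_(v \in box (divlast V mu)) h (concat e u v)|
  <= C * (vprod V `^ alpha * m `^ (- (delta / 2))).
Proof.
move=> r0 eps0 eps_nu eps_delta.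
have [C0 CP] := family_II fam e r0 (ltn0Sn s).
exists (2 * `|C0| * e1 `^ delta); first by rewrite !mulr_ge0 ?powR_ge0.
move=> h Hh U V mu m m1 V1 mue Ve mV Um; have /andP[mu1 mue1] := mue.
have [chr chr0 chrP] := CP h Hh.
have m0 : 0 < m := lt_le_trans ltr01 m1.
have vd := powR_divlast mu1 V1.
have Vl0 : 0 < V ord0 ord_max by apply: lt_le_trans (mV _).
have muV : mu <= V ord0 ord_max.
  by apply: le_trans Ve; apply: (le_trans mue1); rewrite expr2 ler_peMl// ltW.
have V'1 := divlast_ge1 mu1 muV V1.
have me0 : 0 <= m `^ eps by exact: powR_ge0.
(* The range condition of (II) for the shifted vector. Since [mu <= e1] and the last coordinate is
   at least [e1 ^+ 2], the division leaves at least its square root, whence the half in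
   [eps <= nu / 2]. *)
have V'ge : m `^ eps <= vprod (divlast V mu) `^ nu.
  have Vl1 : 0 <= V ord0 ord_max := ltW Vl0.
  have h1 : V ord0 ord_max `^ 2^-1 <= vprod (divlast V mu).
    apply: le_trans (vprod_ge ord_max V'1); rewrite mxE eqxx.
    rewrite ler_pdivlMr ?(lt_le_trans ltr01)//.
    have h2 : mu <= V ord0 ord_max `^ 2^-1.
      apply: (le_trans mue1).
      rewrite -[e1](powRr1 (ltW e1_gt0)) -{1}(mulfV (_ : (2 : R) != 0))//.
      rewrite powRrM powR_lel ?invr_ge0 ?powR_ge0//.
      by rewrite powR_mulrn// ltW.
    apply: (le_trans (ler_wpM2l (powR_ge0 _ _) h2)).
    rewrite -powRD ?(gt_eqF Vl0) ?implybT//.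
    by rewrite (_ : 2^-1 + 2^-1 = 1 :> R) ?powRr1//; lra.
  apply: le_trans (powR_lel (ltW nu0) (powR_ge0 _ _) h1).
  apply: (@le_trans _ _ (V ord0 ord_max `^ eps)).
    by apply: powR_lel; rewrite ?(ltW m0) ?(ltW eps0).
  by rewrite -powRrM mulrC ler_powR.
have Vge : m `^ eps <= vprod V `^ nu.
  apply: (le_trans V'ge); apply: powR_lel; rewrite ?(ltW nu0)//.
    by rewrite (le_trans ler01)// vprod_ge1.
  rewrite vprod_divlast ler_pdivrMr ?(lt_le_trans ltr01)// ler_peMr//.
  by rewrite (le_trans ler01)// vprod_ge1.
rewrite sum_box_sub.
pose err := 2 * `|C0| * e1 `^ delta * (vprod V `^ alpha
   * (m `^ (eps * D) * m `^ (- delta))).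
have err0 : 0 <= err by rewrite !mulr_ge0 ?powR_ge0.
apply: (@le_trans _ _ ((m `^ eps) ^+ r * err)).
  apply: sum_box_norm_le => // u uU.
  have u1 : (maxnorm u)%:R <= m `^ eps by apply: maxnorm_le uU.
  have := chrP V u V1 (le_trans u1 Vge).
  have := chrP _ u V'1 (le_trans u1 V'ge).
  set S' := \sum_(x \in _) _; set S := \sum_(x \in _) _ => h1 h2.
  have -> : S - mu `^ alpha * S' = (S - chr u * vprod V `^ alpha)
    - mu `^ alpha * (S' - chr u * vprod (divlast V mu) `^ alpha).
    by rewrite -vd; ring.
  apply: le_trans (ler_normB _ _) _; rewrite normrM (ger0_norm (powR_ge0 _ _)).
  have uD : (maxnorm u)%:R `^ D <= m `^ (eps * D).
    by rewrite powRrM; apply: powR_lel.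
  have bnd z : z <= e1 `^ delta * m `^ (- delta) -> 0 <= z ->
      C0 * (vprod V `^ alpha * (maxnorm u)%:R `^ D * z) <=
      `|C0| * e1 `^ delta * (vprod V `^ alpha
         * (m `^ (eps * D) * m `^ (- delta))).
    move=> zle z0.
    apply: (@le_trans _ _ (`|C0| * (vprod V `^ alpha * (maxnorm u)%:R `^ D * z))).
      by rewrite ler_wpM2r ?ler_norm// !mulr_ge0 ?powR_ge0.
    rewrite -!mulrA ler_wpM2l// [leRHS]mulrCA ler_wpM2l ?powR_ge0//.
    by rewrite [leRHS]mulrCA ler_pM ?powR_ge0.
  have b1 := bnd _ (vmin_bound m0 mV) (powR_ge0 _ _).
  have b2 := bnd _ (vmin_divlast mue m0 mV) (powR_ge0 _ _).
  have h1' : mu `^ alpha * `|S' - chr u * vprod (divlast V mu) `^ alpha| <=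
    C0 * (vprod V `^ alpha * (maxnorm u)%:R `^ D * vmin (divlast V mu) `^ (- delta)).
    apply: (le_trans (ler_wpM2l (powR_ge0 mu alpha) h1)).
    by rewrite -vd mulrCA !mulrA.
  have := le_trans h2 b1; have := le_trans h1' b2; rewrite /err; lra.
rewrite /err mulrCA ler_wpM2l ?mulr_ge0 ?powR_ge0// mulrCA.
rewrite ler_wpM2l ?powR_ge0// -powR_mulrn// -powRrM.
rewrite -!powRD ?(gt_eqF m0) ?implybT// ler_powR//; lra.
Qed.

End Differences.

(** Condition (II) supplies a separate constant for each split of the coordinates; their sum serves
    for all splits at once. *)
Lemma finite_uniform_bound {R : numDomainType} (I : finType) (P : I -> R -> Prop) :
  (forall i C C', C <= C' -> P i C -> P i C') ->
  (forall i, exists2 C, 0 <= C & P i C) -> exists2 C, 0 <= C & forall i, P i C.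
Proof.
move=> Pmono Pex; have [f f0 fP] : exists2 f : I -> R, (forall i, 0 <= f i)
    & forall i, P i (f i).
  have /choice[f fP] : forall i, exists C, 0 <= C /\ P i C.
    by move=> i; have [C C0 PC] := Pex i; exists C.
  by exists f => i; have [] := fP i.
exists (\sum_i f i) => [|i]; first by rewrite sumr_ge0.
apply: (Pmono _ _ _ _ (fP i)).
by rewrite (bigD1 i)//= lerDl sumr_ge0.
Qed.

Lemma sort_row {R : realDomainType} n (X : 'rV[R]_n) :
  exists p : 'S_n, forall i j : 'I_n, (i <= j)%N -> X ord0 (p i) <= X ord0 (p j).
Proof.
pose t := [tuple X ord0 i | i < n].
have /tuple_permP[p tE] : perm_eq (sort_tuple <=%O t) t by rewrite perm_sort.
have Xp (i : 'I_n) : X ord0 (p i) = nth 0 (sort_tuple <=%O t) i.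
  by rewrite tE -tnth_nth !tnth_mktuple.
exists p => i j ij; rewrite !Xp.
apply: (sorted_leq_nth le_trans lexx) => //; rewrite ?inE ?size_tuple//.
exact: (sort_sorted (@le_total _ _)).
Qed.

(** * Splitting the sorted coordinates at a multiplicative gap *)

Section CoordinateDifference.
Context {R : realType} {k : nat} {alpha c D nu delta : R}.
Context {H : set ('rV[posnat]_k.+1 -> R)} {ch : ('rV[posnat]_k.+1 -> R) -> R}.
Context (alpha0 : 0 < alpha) (delta0 : 0 < delta) (nu0 : 0 < nu) (D0 : 0 <= D).
Context (fam : is_family alpha c D nu delta H ch).

Let e1 : R := expR 1.
Let e1_ge1 : 1 <= e1. Proof. by apply: le_trans (expR_ge1Dx 1); rewrite lerDl. Qed.

Lemma sum_box_bound : exists2 C, 0 <= C & forall h, H h ->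
  forall X : 'rV[R]_k.+1, ge1_vec X ->
  \sum_(x \in box X) h x <= C * vprod X `^ alpha.
Proof.
have [C0 CP] := family_I fam; exists (`|c| + `|C0|); first by rewrite addr_ge0.
move=> h Hh X X1; have := CP h Hh X X1; set S := \sum_(x \in _) _ => hS.
have /andP[_ chc] := family_ch fam Hh.
have vm : vmin X `^ (- delta) <= 1.
  by have := powRN_lel (ltW delta0) ltr01 (vmin_ge X1); rewrite powR1.
have v0 := powR_ge0 (vprod X) alpha.
have h1 : C0 * (vprod X `^ alpha * vmin X `^ (- delta)) <= `|C0| * vprod X `^ alpha.
  apply: (@le_trans _ _ (`|C0| * (vprod X `^ alpha * vmin X `^ (- delta)))).
    by rewrite ler_wpM2r ?ler_norm// mulr_ge0 ?powR_ge0.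
  by rewrite ler_wpM2l// ler_piMr.
have h2 : ch h * vprod X `^ alpha <= `|c| * vprod X `^ alpha.
  by rewrite ler_wpM2r// (le_trans chc)// ler_norm.
have := le_trans hS h1; rewrite mulrDl ler_norml => /andP[_]; lra.
Qed.

(** As the coordinates are sorted, [X ord0 r] is the least of those above the gap and plays the role
    of [m] in [diff_II]. If [r] is 0, all coordinates count as large and (I) takes the place of
    (II). *)
Lemma gap_diff eps : 0 < eps -> eps <= nu / 2 ->
  eps * (k.+1%:R + D) <= delta / 2 ->
  exists2 C, 0 <= C & forall r : 'I_k.+1, forall h, H h ->
  forall (X : 'rV[R]_k.+1) mu, ge1_vec X ->
  (forall i j : 'I_k.+1, (i <= j)%N -> X ord0 i <= X ord0 j) ->
  1 <= mu <= e1 -> e1 ^+ 2 <= X ord0 ord_max ->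
  (forall j : 'I_k.+1, (j < r)%N -> X ord0 j <= X ord0 r `^ eps) ->
  `|\sum_(x \in box X) h x - mu `^ alpha * \sum_(x \in box (divlast X mu)) h x|
  <= C * (vprod X `^ alpha * X ord0 r `^ (- (delta / 2))).
Proof.
move=> eps0 eps_nu eps_delta; apply: finite_uniform_bound => [r C C' CC' CP|r].
  move=> h Hh X mu X1 Xs mue Xe Xgap; apply: (le_trans (CP h Hh X mu X1 Xs mue Xe Xgap)).
  by rewrite ler_wpM2r// mulr_ge0 ?powR_ge0.
have X_e1 (X : 'rV[R]_k.+1) mu : mu <= e1 -> e1 ^+ 2 <= X ord0 ord_max ->
    mu <= X ord0 ord_max.
  move=> mue1 Xe; apply: le_trans Xe; apply: (le_trans mue1).
  by rewrite expr2 ler_peMl// (le_trans ler01).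
have [r0|r0] := posnP r.
  have [C C0 CP] := diff_I delta0 fam; exists C => //.
  move=> h Hh X mu X1 Xs mue Xe _; have /andP[mu1 mue1] := mue.
  have Xr0 : 0 < X ord0 r by exact: lt_le_trans (X1 r).
  apply: (le_trans (CP h Hh X mu _ Xr0 X1 mue (X_e1 _ _ mue1 Xe) _)).
    by move=> j; apply: Xs; rewrite r0.
  rewrite ler_wpM2l// ler_wpM2l ?powR_ge0// ler_powR//.
  by rewrite lerN2 ler_pdivrMr// ler_peMr ?ler1n// ltW.
have rk : (r + (k - r))%N = k by rewrite subnKC// -ltnS.
have e : (r + (k - r).+1)%N = k.+1 by rewrite addnS rk.
have eps_delta' : eps * ((r : nat)%:R + D) <= delta / 2.
  apply: le_trans eps_delta; rewrite ler_wpM2l ?(ltW eps0)// lerD2r ler_nat.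
  exact: ltnW.
have [C C0 CP] := diff_II delta0 nu0 D0 fam e r0 eps0 eps_nu eps_delta'.
exists C => // h Hh X mu X1 Xs mue Xe Xgap.
pose U : 'rV[R]_r := \row_j X ord0 (inord j).
pose V : 'rV[R]_(k - r).+1 := \row_j X ord0 (inord (r + j)).
have XE : X = castmx (erefl 1%N, e) (row_mx U V).
  apply/rowP => j; rewrite castmxE !(ord1 (cast_ord _ _)) !mxE.
  by case: splitP => i /= ji; rewrite mxE -ji inord_val.
have VX : V ord0 ord_max = X ord0 ord_max.
  rewrite mxE; congr (X _ _); apply/val_inj => /=.
  by rewrite /= inordK rk.
have U1 : ge1_vec U by move=> j; rewrite mxE.
have V1 : ge1_vec V by move=> j; rewrite mxE.
rewrite XE divlast_concat !sum_box_concat -XE.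
apply: (le_trans (CP h Hh U V mu (X ord0 r) (X1 r) V1 mue _ _ _)).
- by rewrite VX.
- by move=> j; rewrite mxE; apply: Xs; rewrite inordK ?leq_addr// -[X in (_ < X)%N]e ltn_add2l.
- move=> j; rewrite mxE; apply: Xgap; rewrite inordK//.
  exact: (ltn_trans (ltn_ord j) (ltn_ord r)).
rewrite ler_wpM2l// ler_wpM2r ?powR_ge0// powR_lel ?(ltW alpha0)//.
  by rewrite (le_trans ler01)// vprod_ge1.
by rewrite XE vprod_concat ler_peMl ?vprod_ge1// (le_trans ler01)// vprod_ge1.
Qed.

(* The coordinates below the gap play the role of [u] in (II): they are at most a
   small power of every coordinate above it. *)
Lemma gap_exists (X : 'rV[R]_k.+1) eps : 0 < eps -> eps <= 1 -> ge1_vec X ->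
  (forall i j : 'I_k.+1, (i <= j)%N -> X ord0 i <= X ord0 j) ->
  forall m : nat, (m <= k)%N -> exists2 r : 'I_k.+1,
    forall j : 'I_k.+1, (j < r)%N -> X ord0 j <= X ord0 r `^ eps &
    X ord0 (inord m) `^ (eps ^+ m) <= X ord0 r.
Proof.
move=> eps0 eps1 X1 Xs; elim=> [_|m IH mk].
  exists (inord 0); first by move=> j; rewrite inordK.
  by rewrite expr0 powRr1// (le_trans ler01).
(* If there is no gap at [m.+1], the index found for [m] is kept, at the price of one more factor
   [eps] in the exponent. Index 0 is a gap vacuously. *)
have [gap|gap] := leP (X ord0 (inord m)) (X ord0 (inord m.+1) `^ eps).
  exists (inord m.+1).
    move=> j; rewrite inordK// ltnS => jm; apply: le_trans gap; apply: Xs.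
    by rewrite inordK// ltnS ltnW.
  rewrite -[leRHS]powRr1 ?(le_trans ler01)// ler_powR//.
  by rewrite exprn_ile1// ltW.
have [r rgap rX] := IH (ltnW mk); exists r => //.
apply: le_trans rX; rewrite exprS powRrM powR_lel ?powR_ge0 ?exprn_ge0// ltW//.
Qed.

Lemma sorted_diff : exists2 eta, 0 < eta & exists2 C, 0 <= C &
  forall h, H h -> forall (X : 'rV[R]_k.+1) mu, ge1_vec X ->
  (forall i j : 'I_k.+1, (i <= j)%N -> X ord0 i <= X ord0 j) ->
  1 <= mu <= e1 -> mu <= X ord0 ord_max ->
  `|\sum_(x \in box X) h x - mu `^ alpha * \sum_(x \in box (divlast X mu)) h x|
  <= C * (vprod X `^ alpha * X ord0 ord_max `^ (- eta)).
Proof.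
pose eps := Num.min 1 (Num.min (nu / 2) (delta / 2 / (k.+1%:R + D))).
have kD0 : 0 < k.+1%:R + D by rewrite ltr_wpDr// ltr0n.
have eps0 : 0 < eps by rewrite !lt_min ltr01 !divr_gt0.
have eps1 : eps <= 1 by rewrite ge_min lexx.
have eps_nu : eps <= nu / 2 by rewrite !ge_min lexx !orbT.
have eps_delta : eps * (k.+1%:R + D) <= delta / 2.
  by rewrite -ler_pdivlMr// !ge_min lexx !orbT.
have [C C0 CP] := gap_diff eps0 eps_nu eps_delta.
have [Cb Cb0 CbP] := sum_box_bound.
(* The coordinate at the gap is at least X_max^(eps^k), and the split there saves its power
   [delta / 2]. *)
pose eta := eps ^+ k * (delta / 2).
have eta0 : 0 < eta by rewrite mulr_gt0 ?exprn_gt0// divr_gt0.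
exists eta => //; exists (C + 2 * Cb * (e1 ^+ 2) `^ eta).
  by rewrite addr_ge0// !mulr_ge0 ?powR_ge0.
move=> h Hh X mu X1 Xs mue muX; have /andP[mu1 mue1] := mue.
have Xl0 : 0 < X ord0 ord_max by exact: lt_le_trans (X1 _).
rewrite mulrDl; have [Xe|Xe] := leP (e1 ^+ 2) (X ord0 ord_max).
  have [r rgap rX] := gap_exists eps0 eps1 X1 Xs (leqnn k).
  apply: (le_trans (CP r h Hh X mu X1 Xs mue Xe rgap)).
  rewrite -[leLHS]addr0 lerD//; last by rewrite !mulr_ge0 ?powR_ge0.
  rewrite ler_wpM2l// ler_wpM2l ?powR_ge0//.
  have -> : - eta = eps ^+ k * - (delta / 2) by rewrite mulrN.
  rewrite powRrM; apply: powRN_lel; rewrite ?powR_gt0 ?divr_ge0 ?(ltW delta0)//.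
  by rewrite (_ : ord_max = inord k)//; apply/val_inj; rewrite /= inordK.
(* Here X_max < e^2, so the saving is at most a constant, and the two box sums are bounded
   separately. *)
rewrite -[leLHS]add0r lerD//; first by rewrite !mulr_ge0 ?powR_ge0.
apply: (le_trans (ler_normB _ _)).
rewrite !ger0_norm ?mulr_ge0 ?powR_ge0 ?sum_box_ge0//; try exact: family_ge0 fam _ Hh.
have X'1 := divlast_ge1 mu1 muX X1.
have b1 := CbP h Hh X X1.
have b2 := ler_wpM2l (powR_ge0 mu alpha) (CbP h Hh _ X'1).
move: b2; rewrite mulrCA (powR_divlast mu1 X1) => b2.
apply: (le_trans (lerD b1 b2)).
have q : 1 <= (e1 ^+ 2) `^ eta * X ord0 ord_max `^ (- eta).
  rewrite powRN ler_pdivlMr ?powR_gt0// mul1r.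
  by apply: powR_lel; rewrite ltW.
have := ler_wpM2l (mulr_ge0 Cb0 (powR_ge0 (vprod X) alpha)) q.
lra.
Qed.

Definition divat (X : 'rV[R]_k.+1) j0 mu : 'rV[R]_k.+1 :=
  \row_j (if j == j0 then X ord0 j / mu else X ord0 j).

Lemma coordinate_diff : exists2 eta, 0 < eta & exists2 C, 0 <= C &
  forall h, H h -> forall (X : 'rV[R]_k.+1) mu j0, ge1_vec X ->
  (forall i, X ord0 i <= X ord0 j0) -> 1 <= mu <= e1 -> mu <= X ord0 j0 ->
  `|\sum_(x \in box X) h x - mu `^ alpha * \sum_(x \in box (divat X j0 mu)) h x|
  <= C * (vprod X `^ alpha * X ord0 j0 `^ (- eta)).
Proof.
have [eta eta0 [C C0 CP]] := sorted_diff; exists eta => //; exists C => //.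
move=> h Hh X mu j0 X1 Xj0 mue muX.
have [p ps] := sort_row X.
(* The sorting permutation may put another maximal coordinate last. A transposition moves [j0]
   there, and the order survives because the two entries exchanged are equal. *)
pose s : 'S_k.+1 := (tperm ord_max (p^-1%g j0) * p)%g.
have sl : s ord_max = j0 by rewrite permM tpermL permKV.
have sp i : X ord0 (s i) = X ord0 (p i).
  have top : X ord0 j0 = X ord0 (p ord_max).
    apply/eqP; rewrite eq_le Xj0 andbT -[j0](permKV p).
    by apply: ps; rewrite -ltnS.
  by rewrite permM; case: tpermP => [->|->|//]; rewrite permKV top.
have hp (Y : 'rV[R]_k.+1) : \sum_(x \in box Y) h x =
    \sum_(x \in box (col_perm s Y)) hperm s^-1%g h x.
  rewrite sum_box_hperm; congr (\sum_(x \in box _) h x).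
  by apply/matrixP => i j; rewrite !mxE permKV.
rewrite !hp.
have -> : col_perm s (divat X j0 mu) = divlast (col_perm s X) mu.
  by apply/rowP => j; rewrite !mxE -[in LHS]sl (inj_eq perm_inj).
apply: (le_trans (CP _ (family_III fam s^-1%g Hh) (col_perm s X) mu _ _ mue _)).
- by move=> j; rewrite mxE.
- by move=> i j ij; rewrite !mxE !sp ps.
- by rewrite mxE sl.
rewrite mxE sl (_ : vprod (col_perm s X) = vprod X)//.
rewrite /vprod [RHS](reindex_inj (@perm_inj _ s)).
by apply: eq_bigr => j _; rewrite mxE.
Qed.

End CoordinateDifference.

(** * Backward differences and diagonal sums *)

Section BackwardDifference.
Context {R : comNzRingType}.
Implicit Types (t : R) (u v : nat -> R).

(* The power series of [nab t u] is [1 - t z] times that of [u]. *)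
Definition nab t u (M : nat) : R := u M - (if M is M'.+1 then t * u M' else 0).

Lemma nabC t t' u : nab t (nab t' u) = nab t' (nab t u).
Proof. by apply/funext => -[|[|M]]; rewrite /nab /=; ring. Qed.

Lemma iter_nabC t t' m n u :
  iter m (nab t) (iter n (nab t') u) = iter n (nab t') (iter m (nab t) u).
Proof.
have aux v : nab t (iter n (nab t') v) = iter n (nab t') (nab t v).
  by elim: n => //= n IHn; rewrite nabC IHn.
by elim: m => //= m ->; rewrite aux.
Qed.

Lemma iter_nab_sum (T : Type) (s : seq T) (a : T -> R) t n (u : T -> nat -> R) :
  iter n (nab t) (fun M => \sum_(x <- s) a x * u x M) =
  fun M => \sum_(x <- s) a x * iter n (nab t) (u x) M.
Proof.
elim: n => //= n ->; apply/funext => -[|M]; rewrite /nab.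
  by rewrite subr0; apply: eq_bigr => x _; rewrite subr0.
rewrite mulr_sumr -sumrB; apply: eq_bigr => x _; ring.
Qed.

Lemma eq_nab t u v B : (forall M, (M < B)%N -> u M = v M) ->
  forall M, (M < B)%N -> nab t u M = nab t v M.
Proof.
move=> uv [|M] MB; rewrite /nab uv//.
by rewrite uv// ltnW.
Qed.

Lemma eq_iter_nab n t u v B : (forall M, (M < B)%N -> u M = v M) ->
  forall M, (M < B)%N -> iter n (nab t) u M = iter n (nab t) v M.
Proof. by move=> uv; elim: n => //= n IH; exact: eq_nab. Qed.

(** The power series 1 - t z has constant term 1, hence is invertible. *)
Lemma nab_inj t u v B : (forall M, (M < B)%N -> nab t u M = nab t v M) ->
  forall M, (M < B)%N -> u M = v M.
Proof.
move=> uv; elim=> [|M IH] MB; first by have := uv _ MB; rewrite /nab !subr0.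
by have := uv _ MB; rewrite /nab IH ?(ltnW MB)// => /addIr.
Qed.

Lemma coef_nab t (p : {poly R}) n :
  (fun M => ((1 - t *: 'X) ^+ n * p)`_M) = iter n (nab t) (fun M => p`_M).
Proof.
elim: n => [|n IH]; first by apply/funext => M; rewrite expr0 mul1r.
rewrite iterS -IH; apply/funext => M; rewrite exprS -mulrA mulrBl mul1r.
rewrite coefB -scalerAl coefZ coefXM /nab.
by case: M => //=; rewrite mulr0.
Qed.

Section Diagonal.
Context {k : nat}.
Implicit Types (psi : 'I_k -> nat -> R).

(* The bound [B] only serves to make the sum finite: for [M < B] this is the
   M-th coefficient of the product of the power series of the [psi j]. *)
Definition diag (B : nat) psi (M : nat) : R :=
  \sum_(n : {ffun 'I_k -> 'I_B} | (\sum_j n j)%N == M) \prod_j psi j (n j).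

Lemma diag_coef B psi M : diag B psi M = (\prod_j \poly_(i < B) psi j i)`_M.
Proof.
under eq_bigr do rewrite poly_def.
rewrite bigA_distr_bigA coef_sum /diag big_mkcond; apply: eq_bigr => n _.
under [in RHS]eq_bigr do rewrite -mul_polyC.
rewrite big_split /= -rmorph_prod -expr_sum mul_polyC coefZ coefXn eq_sym.
by case: ifP => _; rewrite ?mulr1 ?mulr0.
Qed.

Lemma coef_prod_eq (p q : 'I_k -> {poly R}) B :
  (forall j m, (m < B)%N -> (p j)`_m = (q j)`_m) ->
  forall m, (m < B)%N -> (\prod_j p j)`_m = (\prod_j q j)`_m.
Proof.
move=> pq; elim/big_rec2: _ => // j a b _ ab m mB.
rewrite !coefM; apply: eq_bigr => i _; rewrite pq ?ab//.
  by rewrite (leq_ltn_trans (leq_subr _ _)).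
by apply: leq_ltn_trans mB; rewrite -ltnS.
Qed.

(** There are [k] factors [psi j] and [k] differences, so each factor of the product absorbs one 1 -
    t z. *)
Lemma nab_diag B psi t M : (M < B)%N ->
  iter k (nab t) (diag B psi) M = diag B (fun j => nab t (psi j)) M.
Proof.
move=> MB; rewrite (_ : diag B psi = fun M => (\prod_j \poly_(i < B) psi j i)`_M);
  last by apply/funext => m; rewrite diag_coef.
rewrite -coef_nab diag_coef.
have -> : (1 - t *: 'X) ^+ k * \prod_j \poly_(i < B) psi j i =
    \prod_j ((1 - t *: 'X) * \poly_(i < B) psi j i).
  by rewrite big_split /= prodr_const card_ord.
move: M MB; apply: coef_prod_eq => j i iB.
have := congr1 (fun f => f (i : nat)) (coef_nab t (\poly_(i < B) psi j i) 1).
rewrite expr1 /= => ->; rewrite coef_poly iB.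
by apply: (@eq_nab _ _ _ B) => // l lB; rewrite coef_poly lB.
Qed.

Lemma diag_widen B B' psi M : (M < B)%N -> (M < B')%N ->
  diag B psi M = diag B' psi M.
Proof.
wlog BB' : B B' / (B <= B')%N.
  by move=> wl MB MB'; case: (leqP B B') => [|/ltnW] BB'; [|symmetry]; exact: wl.
move=> MB _; rewrite !diag_coef; move: M MB; apply: coef_prod_eq => j m mB.
by rewrite !coef_poly mB (leq_trans mB BB').
Qed.

(** The coefficients of z^a / (1 - z). *)
Definition step (a M : nat) : R := (a <= M)%N%:R.

Lemma nab_step a : nab 1 (step a) = fun M => (a == M)%:R.
Proof.
apply/funext => -[|M]; rewrite /nab /step; first by rewrite subr0 leqn0.
rewrite mul1r leq_eqVlt ltnS.
case: eqP => [->|_] /=; first by rewrite ltnn subr0.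
by rewrite subrr.
Qed.

Lemma diag_delta B (a : 'I_k -> nat) M : (M < B)%N ->
  diag B (fun j m => (a j == m)%:R) M = ((\sum_j a j)%N == M)%:R.
Proof.
move=> MB; have prodE (n : {ffun 'I_k -> 'I_B}) :
    \prod_j (a j == n j)%:R = [forall j, a j == n j]%:R :> R.
  case: forallP => [an|/forallP]; first by rewrite big1// => j _; rewrite (an j).
  rewrite negb_forall => /existsP[j /negbTE aj]; rewrite (bigD1 j)//= aj mul0r//.
rewrite /diag (eq_bigr (fun n : {ffun 'I_k -> 'I_B} => [forall j, a j == n j]%:R));
  last by move=> n _; exact: prodE.
have [aM|aM] := eqVneq (\sum_j a j)%N M; last first.
  rewrite big1// => n nM; case: forallP => // an; case/negP: aM.
  by rewrite -(eqP nM); apply/eqP; apply: eq_bigr => j _; apply/eqP.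
have aB j : (a j < B)%N.
  by apply: leq_ltn_trans MB; rewrite -aM (bigD1 j)//= leq_addr.
rewrite (bigD1 [ffun j => Ordinal (aB j)])/=; last first.
  by rewrite -aM; apply/eqP/eq_bigr => j _; rewrite ffunE.
rewrite big1 ?addr0 => [|n /andP[_ nE]].
  by case: forallP => // -[] j; rewrite ffunE.
case: forallP => // an; case/eqP: nE; apply/ffunP => j; rewrite ffunE.
by apply/val_inj => /=; apply/esym/eqP/an.
Qed.

End Diagonal.

(** The product of the [k.+1] series z^(a j) / (1 - z), times (1 - z)^k, is z^(sum of the a j) / (1
    - z). This is what turns diagonal sums of box sums into partial sums over cells. *)
Lemma iter_nab_step k B (a : 'I_k.+1 -> nat) M : (M < B)%N ->
  iter k (nab 1) (diag B (fun j => step (a j))) M = step (\sum_j a j) M.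
Proof.
move: M; apply: (@nab_inj 1) => M MB; rewrite nab_step -iterS nab_diag//.
by rewrite -(diag_delta a MB); apply: eq_bigr => n _; apply: eq_bigr => j _; rewrite nab_step.
Qed.

End BackwardDifference.

(** * Sums over the cells of a geometric grid *)

(** [cell m] is the index of the grid cell containing [m]. The equivalence makes [step (cell m) n]
    the indicator of m <= e^(w n). *)
Lemma cell_exists {R : realType} (w : R) : 0 < w ->
  exists cell : nat -> nat,
    forall m n, (cell m <= n)%N = (m%:R <= expR (w * n%:R)).
Proof.
move=> w0.
have ex m : exists n, m%:R <= expR (w * n%:R).
  exists (Num.truncn (m%:R / w)).+1; apply: le_trans (expR_ge1Dx _).
  have := ltW (truncnS_gt (m%:R / w)); rewrite ler_pdivrMr// => ?.
  by rewrite -[leLHS]add0r lerD// mulrC.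
exists (fun m => ex_minn (ex m)) => m n; case: ex_minnP => c cm cmin.
apply/idP/idP => [cn|/cmin//]; apply: (le_trans cm).
by rewrite ler_expR ler_pM2l// ler_nat.
Qed.

Section Grid.
Context {R : realType} {k : nat}.

Definition gridvec (w : R) (n : 'I_k.+1 -> nat) : 'rV[R]_k.+1 :=
  \row_j expR (w * (n j)%:R).

Lemma gridvec_ge1 w n : 0 <= w -> ge1_vec (gridvec w n).
Proof. by move=> w0 j; rewrite mxE -expR0 ler_expR mulr_ge0. Qed.

Lemma vprod_gridvec w n : vprod (gridvec w n) = expR (w * (\sum_j n j)%:R).
Proof.
rewrite /vprod (eq_bigr (fun j => expR (w * (n j)%:R))) => [|j _]; last by rewrite mxE.
by rewrite -expR_sum -mulr_sumr natr_sum.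
Qed.

(* The coefficients of [prod_j (1 - t z_j)] times the generating series of the sums
   of [h] over the boxes [gridvec w n]. *)
Definition mixed_diff (cell : nat -> nat) (t : R) (s : seq 'rV[posnat]_k.+1)
    (h : 'rV[posnat]_k.+1 -> R) (n : 'I_k.+1 -> nat) : R :=
  \sum_(x <- s) h x * \prod_j nab t (step (cell (val (x ord0 j)))) (n j).

Lemma sum_step w cell (h : 'rV[posnat]_k.+1 -> R) B (n : 'I_k.+1 -> nat) :
  (forall m n, (cell m <= n)%N = (m%:R <= expR (w * n%:R))) ->
  (forall j, expR (w * (n j)%:R) <= B%:R) ->
  \sum_(x <- cube k.+1 B) h x * \prod_j step (cell (val (x ord0 j))) (n j) =
  \sum_(x \in box (gridvec w n)) h x.
Proof.
move=> cellP nB.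
have sub : box (gridvec w n) `<=` [set` cube k.+1 B].
  by apply: box_sub_cube => j; rewrite mxE.
rewrite (fsum_seq _ (cube_uniq k.+1 B) sub) [RHS]big_mkcond.
apply: eq_bigr => x _; case: ifPn => [/set_mem xn|].
  rewrite big1 ?mulr1// => j _; rewrite /step cellP.
  by have := xn j; rewrite mxE => ->.
rewrite notin_setE => /existsNP[j /negP jn].
rewrite (bigD1 j)//= [step _ _](_ : _ = 0) ?mul0r ?mulr0//.
rewrite /step cellP; move: jn; rewrite mxE => /negbTE ->//.
Qed.

Context {alpha c D nu delta : R}.
Context {H : set ('rV[posnat]_k.+1 -> R)} {ch : ('rV[posnat]_k.+1 -> R) -> R}.
Context (alpha0 : 0 < alpha) (delta0 : 0 < delta) (nu0 : 0 < nu) (D0 : 0 <= D).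
Context (fam : is_family alpha c D nu delta H ch).

(* Expanding the product over [j != j0], where [n j0] is maximal, leaves differences
   of box sums in the single direction [j0]. *)
Lemma mixed_diff_bound : exists2 eta, 0 < eta & exists2 C, 0 <= C &
  forall h, H h -> forall w cell B (n : 'I_k.+1 -> nat), 0 < w <= 1 ->
  (forall m n, (cell m <= n)%N = (m%:R <= expR (w * n%:R))) ->
  (forall j, expR (w * (n j)%:R) <= B%:R) ->
  `|mixed_diff cell (expR (alpha * w)) (cube k.+1 B) h n| <=
  C * expR ((alpha - eta) * (w * (\sum_j n j)%:R)).
Proof.
have [eta eta0 [C C0 CP]] := coordinate_diff alpha0 delta0 nu0 D0 fam.
have [Cb Cb0 CbP] := sum_box_bound delta0 fam.
(* The largest index is at least the average, so a saving in the largest coordinate is one in the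
   index sum, with the rate divided by [k.+1]. *)
pose eta' := eta / k.+1%:R.
exists eta'; first by rewrite divr_gt0.
pose C' := expR (alpha * k.+1%:R) * C.
have C'0 : 0 <= C' by rewrite mulr_ge0 ?expR_ge0.
exists (Cb + #|{set 'I_k.+1}|%:R * C').
  by rewrite addr_ge0// mulr_ge0.
move=> h Hh w cell B n /andP[w0 w1] cellP nB.
set t := expR (alpha * w).
have t0 : 0 < t by exact: expR_gt0.
have t1 : 1 <= t by rewrite -expR0 ler_expR mulr_ge0// ltW.
have tw : expR w `^ alpha = t by rewrite -expRM mulrC.
pose j0 := [arg max_(j > ord0) n j].
have j0P j : (n j <= n j0)%N by rewrite /j0; case: arg_maxnP => // i _; apply.
have sumn : (\sum_j n j <= k.+1 * n j0)%N.
  rewrite -[X in (_ <= X * _)%N]card_ord -sum_nat_const.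
  by apply: leq_sum => j _.
set S := (\sum_j n j)%N in sumn *.
have bound m : (forall j, (m j <= n j)%N) ->
    vprod (gridvec w m) `^ alpha <= expR (alpha * (w * S%:R)).
  move=> mn; rewrite vprod_gridvec -expRM mulrC ler_expR.
  by rewrite ler_pM2l// ler_pM2l// ler_nat leq_sum.
(* If all indices vanish, no shift is possible, and the mixed difference is the sum over the box of
   side 1. *)
have [nj0|nj0] := posnP (n j0).
  have n0 j : n j = 0%N by apply/eqP; rewrite -leqn0 -nj0.
  have -> : mixed_diff cell t (cube k.+1 B) h n = \sum_(x \in box (gridvec w n)) h x.
    rewrite -(sum_step h cellP nB); apply: eq_bigr => x _; congr (_ * _).
    by apply: eq_bigr => j _; rewrite n0 /nab subr0.
  have S0 : S = 0%N by rewrite /S big1.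
  rewrite S0 !mulr0 expR0 mulr1 ger0_norm; last exact/sum_box_ge0/(family_ge0 fam Hh).
  apply: (le_trans (CbP h Hh _ (gridvec_ge1 _ (ltW w0)))).
  rewrite vprod_gridvec -/S S0 mulr0 expR0 powR1 mulr1.
  by rewrite lerDl mulr_ge0.
pose nJ (J : {set 'I_k.+1}) j := if j \in J then n j else (n j).-1.
(* For [j != j0] the difference is split into its unshifted part [A] and its shifted part [A']; for
   [j0] it stays whole in [A], so only sets [J] containing [j0] contribute. The other shifts only
   lower coordinates, hence [j0] remains maximal. *)
pose A (x : 'rV[posnat]_k.+1) (j : 'I_k.+1) : R := if j == j0 then nab t (step (cell (val (x ord0 j)))) (n j)
  else step (cell (val (x ord0 j))) (n j).
pose A' (x : 'rV[posnat]_k.+1) (j : 'I_k.+1) : R := if j == j0 then 0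
  else - (if n j is m'.+1 then t * step (cell (val (x ord0 j))) m' else 0).
have AA' (x : 'rV[posnat]_k.+1) (j : 'I_k.+1) : nab t (step (cell (val (x ord0 j)))) (n j) = A x j + A' x j.
  by rewrite /A /A' /nab; case: eqP => _; rewrite ?addr0.
pose G (J : {set 'I_k.+1}) := \sum_(x <- cube k.+1 B) h x *
   \prod_j (if j \in J then A x j else A' x j).
have -> : mixed_diff cell t (cube k.+1 B) h n = \sum_(J in {set 'I_k.+1}) G J.
  rewrite /G exchange_big /=; apply: eq_bigr => x _.
  rewrite -mulr_sumr; congr (_ * _); rewrite -bigA_distr.
  by apply: eq_bigr => j _.
have Gbound J : `|G J| <= C' * expR ((alpha - eta') * (w * S%:R)).
  have rhs0 : 0 <= C' * expR ((alpha - eta') * (w * S%:R)).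
    by rewrite mulr_ge0 ?expR_ge0.
  have [j0J|j0J] := boolP (j0 \in J); last first.
    rewrite /G big1 ?normr0// => x _.
    by rewrite (bigD1 j0)//= (negbTE j0J) /A' eqxx mul0r mulr0.
  (* A shift below index 0 is 0 by the definition of [nab], and then the whole term of [J]
     vanishes. *)
  have [nz|] := boolP [forall j, (j \notin J) ==> (0 < n j)%N]; last first.
    rewrite negb_forall => /existsP[j]; rewrite negb_imply -leqNgt leqn0.
    move=> /andP[jJ /eqP nj]; rewrite /G big1 ?normr0// => x _.
    rewrite (bigD1 j)//= (negbTE jJ) /A' nj.
    by case: eqP => _; rewrite ?oppr0 mul0r mulr0.
  have nJn j : (nJ J j <= n j)%N by rewrite /nJ; case: ifP; rewrite ?leq_pred.
  have GE : G J = (- t) ^+ #|~: J| *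
     (\sum_(x \in box (gridvec w (nJ J))) h x -
      t * \sum_(x \in box (divat (gridvec w (nJ J)) j0 (expR w))) h x).
    pose nJ' j := if j == j0 then (n j).-1 else nJ J j.
    have -> : divat (gridvec w (nJ J)) j0 (expR w) = gridvec w nJ'.
      apply/rowP => j; rewrite !mxE /nJ'; case: eqP => // ->.
      rewrite /nJ j0J -expRN -expRD -[in LHS](prednK nj0) -natr1; congr expR; ring.
    have leB m : (forall j, (m j <= n j)%N) -> forall j, expR (w * (m j)%:R) <= B%:R.
      move=> mn j; apply: le_trans (nB j).
      by rewrite ler_expR ler_pM2l// ler_nat.
    have nJ'n j : (nJ' j <= n j)%N.
      by rewrite /nJ' /nJ; case: eqP => [->|_]; [|case: ifP => _]; rewrite ?leq_pred.
    rewrite -(sum_step h cellP (leB _ nJn)) -(sum_step h cellP (leB _ nJ'n)).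
    rewrite mulr_sumr -sumrB mulr_sumr; apply: eq_bigr => x _.
    rewrite [X in _ = _ * (_ - X)]mulrCA -mulrBr [RHS]mulrCA; congr (_ * _).
    have -> : (- t) ^+ #|~: J| = \prod_j (if j \in J then 1 else - t).
      rewrite -prodr_const big_mkcond; apply: eq_bigr => j _.
      by rewrite finset.in_setC; case: (j \in J).
    rewrite (bigD1 j0)//= [in RHS](bigD1 j0)//= j0J mul1r.
    rewrite [in X in _ = _ * (X - _)](bigD1 j0)//= [in X in _ = _ * (_ - t * X)](bigD1 j0)//=.
    have -> : A x j0 = step (cell (val (x ord0 j0))) (nJ J j0)
        - t * step (cell (val (x ord0 j0))) (nJ' j0).
      by rewrite /A eqxx /nJ j0J /nJ' eqxx /nab; case: (n j0) nj0.
    rewrite (eq_bigr (fun j => (if j \in J then 1 else - t) *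
       step (cell (val (x ord0 j))) (nJ J j))); last first.
      move=> j jj0; rewrite /A /A' (negbTE jj0) /nJ; case: ifPn => jJ.
        by rewrite mul1r.
      have := forallP nz j; rewrite jJ /=; case: (n j) => //= m _.
      by rewrite mulNr.
    rewrite [X in _ = _ * (_ - t * (_ * X))](eq_bigr
      (fun j => step (cell (val (x ord0 j))) (nJ J j))); last first.
      by move=> j jj0; rewrite /nJ' (negbTE jj0).
    by rewrite big_split /=; ring.
  rewrite GE normrM normrX normrN (ger0_norm (ltW t0)) -tw.
  have Xj0 : gridvec w (nJ J) ord0 j0 = expR (w * (n j0)%:R).
    by rewrite mxE /nJ j0J.
  have le1 : `|\sum_(x \in box (gridvec w (nJ J))) h x - expR w `^ alpha *
      \sum_(x \in box (divat (gridvec w (nJ J)) j0 (expR w))) h x|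
      <= C * expR ((alpha - eta') * (w * S%:R)).
    apply: (le_trans (CP h Hh _ _ _ (gridvec_ge1 _ (ltW w0)) _ _ _)).
    - move=> i; rewrite Xj0 mxE ler_expR ler_pM2l// ler_nat.
      exact: (leq_trans (nJn i)).
    - by rewrite ler_expR w1 andbT -expR0 ler_expR ltW.
    - by rewrite Xj0 ler_expR ler_peMr ?(ltW w0)// ler1n.
    rewrite ler_wpM2l// mulrBl expRD; apply: ler_pM; rewrite ?powR_ge0//.
      exact: bound.
    rewrite Xj0 -expRM ler_expR mulrN lerN2.
    have sumn' : S%:R <= k.+1%:R * (n j0)%:R :> R by rewrite -natrM ler_nat.
    have ew0 : 0 <= eta * w / k.+1%:R by rewrite divr_ge0// mulr_ge0// ltW.
    have := ler_wpM2l ew0 sumn'; rewrite /eta'.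
    have -> : eta * w / k.+1%:R * (k.+1%:R * (n j0)%:R) = w * (n j0)%:R * eta.
      by field; rewrite nat1r pnatr_eq0.
    by congr (_ <= _); ring.
  have le2 : expR w `^ alpha ^+ #|~: J| <= expR (alpha * k.+1%:R).
    rewrite -expRM -expRM_natl ler_expR mulrC [w * _]mulrC -mulrA ler_pM2l//.
    apply: (@le_trans _ _ (1 * #|~: J|%:R)); first by rewrite ler_wpM2r.
    by rewrite mul1r ler_nat -[leqRHS]card_ord max_card.
  rewrite /C' -[leRHS]mulrA; apply: ler_pM => //.
apply: (le_trans (ler_norm_sum _ _ _)).
apply: (le_trans (ler_sum _ (fun J _ => Gbound J))).
rewrite (_ : \sum_(J in _) _ = #|{set 'I_k.+1}|%:R * C' *
  expR ((alpha - eta') * (w * S%:R))); last first.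
  by rewrite sumr_const -[RHS]mulrA mulr_natl; congr (_ *+ _); exact: eq_card.
rewrite [leRHS]mulrDl lerDr.
by rewrite mulr_ge0 ?expR_ge0.
Qed.

End Grid.

(** * Sequences attached to a grid *)

Section NabReal.
Context {R : realType}.

Lemma iter_nab_bound n (t : R) (u b : nat -> R) B : 0 <= t ->
  (forall M M', (M <= M')%N -> b M <= b M') ->
  (forall M, (M < B)%N -> `|u M| <= b M) ->
  forall M, (M < B)%N -> `|iter n (nab t) u M| <= (1 + t) ^+ n * b M.
Proof.
move=> t0 bmono ub; elim: n => [|n IH] M MB; first by rewrite mul1r; exact: ub.
rewrite iterS exprS -mulrA; set b' := _ ^+ n * b M.
have b'M := IH M MB; rewrite /nab; apply: (le_trans (ler_normB _ _)).
rewrite mulrDl mul1r lerD//; case: M MB @b' b'M => [|M] MB b' b'M.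
  by rewrite normr0 mulr_ge0// (le_trans _ b'M).
rewrite normrM ger0_norm// ler_wpM2l//; apply: (le_trans (IH _ (ltnW MB))).
by rewrite ler_wpM2l ?exprn_ge0 ?addr_ge0// bmono.
Qed.

(** With these weights the differences telescope. This inverts [nab], and is applied both to the
    diagonal sums and, on a cube, in each coordinate. *)
Lemma sum_nab (a : R) (u : nat -> R) M :
  \sum_(m < M.+1) expR (- (a * m%:R)) * nab (expR a) u m = expR (- (a * M%:R)) * u M.
Proof.
elim: M => [|M IH]; first by rewrite big_ord1 /nab mulr0 subr0.
rewrite big_ord_recr /= IH /nab mulrBr addrC mulrA.
rewrite -expRD (_ : _ + a = - (a * M%:R)); first by rewrite subrK.
by rewrite -natr1; ring.
Qed.

End NabReal.

(* In the application [U L] is [Upsilon h (expR L)], [cc] is [ch h], [T M] is the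
   sum of [h] over the cells of the grid of ratio [expR w] whose indices add up
   to at most [M], and [expR (alpha * w * M) * z M] is obtained from the sums of
   [h] over boxes of index sum [M] by [k] differences. [Bd] truncates [M]. *)
Definition grid_approx {R : realType} (alpha eta C : R) (k : nat) (cc : R)
    (U : R -> R) :=
  forall (w : R) (Bd : nat), 0 < w <= 1 ->
  exists T z : nat -> R,
  [/\ forall M, (M < Bd)%N -> 0 <= T M <= U (w * M%:R),
      forall M, (M + k.+1 < Bd)%N -> U (w * M%:R) <= T (M + k.+1)%N,
      forall M, (M < Bd)%N -> T M <= C * M.+1%:R ^+ k.+1 * expR (alpha * (w * M%:R)),
      forall M, (M < Bd)%N -> `|iter k.+1 (nab (expR (alpha * w))) T M| <=
        C * M.+1%:R ^+ k.+1 * expR ((alpha - eta) * (w * M%:R)) &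
      (forall M, (M < Bd)%N -> iter k (nab (expR (alpha * w))) T M =
        iter k (nab 1) (fun M => expR (alpha * w * M%:R) * z M) M) /\
      (forall M, (M < Bd)%N -> `|z M - cc| <=
        C * M.+1%:R ^+ k.+1 * expR (- (eta * (w * (M %/ k.+1)%:R))))].

Section GridSequences.
Context {R : realType} {k : nat} {alpha c D nu delta : R}.
Context {H : set ('rV[posnat]_k.+1 -> R)} {ch : ('rV[posnat]_k.+1 -> R) -> R}.
Context (alpha0 : 0 < alpha) (delta0 : 0 < delta) (nu0 : 0 < nu) (D0 : 0 <= D).
Context (fam : is_family alpha c D nu delta H ch).

Lemma hyperbolic_sub_cube (N : R) B : N <= B%:R ->
  hyperbolic (k := k.+1) N `<=` [set` cube k.+1 B].
Proof.
move=> NB x xN /=; apply: mem_cube => j; rewrite -(ler_nat R).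
apply: le_trans NB; apply: le_trans xN; rewrite ler_nat (bigD1 j)//=.
rewrite leq_pmulr// prodn_gt0// => i; exact: (valP (x ord0 i)).
Qed.

Lemma grid_sequences : exists2 eta, 0 < eta & eta <= alpha /\
  exists2 C, 0 <= C &
  forall h, H h ->
    grid_approx alpha eta C k (ch h) (fun L => Upsilon h (expR L)).
Proof.
have [eta1 eta10 [C1 C10 C1P]] := mixed_diff_bound alpha0 delta0 nu0 D0 fam.
have [Cb Cb0 CbP] := sum_box_bound delta0 fam.
have [C0 C0P] := family_I fam.
(* [eta <= alpha] makes the bounds nondecreasing in [M], as [iter_nab_bound] demands; [eta <= delta]
   is for the cube evaluated by (I). *)
pose eta := Num.min eta1 (Num.min alpha delta).
have eta0 : 0 < eta by rewrite !lt_min eta10 alpha0.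
have eta_alpha : eta <= alpha by rewrite !ge_min lexx orbT.
have eta_delta : eta <= delta by rewrite !ge_min lexx !orbT.
have eta_eta1 : eta <= eta1 by rewrite ge_min lexx.
exists eta => //; split => //.
pose C := 2 ^+ k * (C1 + Cb) + `|C0|.
have C_ge0 : 0 <= C by rewrite addr_ge0// mulr_ge0// ?exprn_ge0 ?addr_ge0.
exists C => // h Hh w Bd /andP[w0 w1].
have h0 := family_ge0 fam Hh.
set t := expR (alpha * w).
have [cell cellP] := cell_exists w0.
set B := (Num.truncn (expR (w * Bd%:R))).+1.
have MB M : (M <= Bd)%N -> expR (w * M%:R) <= B%:R.
  move=> MBd; apply: le_trans (ltW (truncnS_gt _)).
  by rewrite ler_expR ler_pM2l// ler_nat.
set s := cube k.+1 B.
pose a (x : 'rV[posnat]_k.+1) j := cell (val (x ord0 j)).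
(* [Phi M] adds up the box sums of index sum [M], and [Hh'] the mixed differences. The sequence [u]
   stops one difference short of [Hh'], so that it retains the main term, of order t^M. *)
pose T M := \sum_(x <- s) h x * step (R := R) (\sum_j a x j) M.
pose Phi M := \sum_(x <- s) h x * diag (R := R) Bd (fun j => step (a x j)) M.
pose Hh' M := \sum_(x <- s) h x * diag Bd (fun j => nab t (step (a x j))) M.
pose u := iter k (nab t) Phi.
have TPhi M : (M < Bd)%N -> T M = iter k (nab 1) Phi M.
  move=> MBd; rewrite iter_nab_sum; apply: eq_bigr => x _; congr (_ * _).
  by rewrite iter_nab_step.
have PhiH M : (M < Bd)%N -> iter k.+1 (nab t) Phi M = Hh' M.
  move=> MBd; rewrite iter_nab_sum; apply: eq_bigr => x _; congr (_ * _).
  by rewrite nab_diag.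
have expand B' (psi : 'rV[posnat]_k.+1 -> 'I_k.+1 -> nat -> R) M :
    (M < Bd)%N -> (M < B')%N ->
    \sum_(x <- s) h x * diag Bd (psi x) M =
    \sum_(n : {ffun 'I_k.+1 -> 'I_B'} | (\sum_j n j)%N == M)
      \sum_(x <- s) h x * \prod_j psi x j (n j).
  move=> MBd MB'; rewrite exchange_big /=; apply: eq_bigr => x _.
  by rewrite -mulr_sumr (@diag_widen _ _ Bd B').
have card_le M (P : pred {ffun 'I_k.+1 -> 'I_M.+1}) (f : {ffun 'I_k.+1 -> 'I_M.+1} -> R) e :
    0 <= e -> (forall n, P n -> `|f n| <= e) ->
    `|\sum_(n | P n) f n| <= M.+1%:R ^+ k.+1 * e.
  move=> e0 fe; apply: (le_trans (ler_norm_sum _ _ _)).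
  apply: (@le_trans _ _ (\sum_(n : {ffun 'I_k.+1 -> 'I_M.+1}) e)).
    rewrite big_mkcond; apply: ler_sum => n _; case: ifP => [/fe//|_]; exact: e0.
  by rewrite sumr_const card_ffun !card_ord -natrX mulr_natl.
have mixedB M (n : {ffun 'I_k.+1 -> 'I_M.+1}) : (M < Bd)%N ->
    `|mixed_diff cell t s h (fun j => n j : nat)| <=
    C1 * expR ((alpha - eta) * (w * (\sum_j n j)%:R)).
  move=> MBd; apply: (le_trans (C1P h Hh w cell B (fun j => n j : nat) _ cellP _)).
  - by rewrite w0.
  - by move=> j; apply: MB; apply: leq_trans MBd; exact: ltnW.
  rewrite ler_wpM2l// ler_expR ler_wpM2r ?mulr_ge0 ?(ltW w0)//.
  by rewrite lerD2l lerN2.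
have bmono A e : 0 <= A -> 0 <= e -> forall M M', (M <= M')%N ->
    A * M.+1%:R ^+ k.+1 * expR (e * (w * M%:R)) <=
    A * M'.+1%:R ^+ k.+1 * expR (e * (w * M'%:R)).
  move=> A0 e0 M M' MM'; apply: ler_pM; rewrite ?mulr_ge0 ?exprn_ge0 ?expR_ge0//.
    by rewrite ler_wpM2l// lerXn2r ?nnegrE// ler_nat ltnS.
  by rewrite ler_expR ler_wpM2l// ler_wpM2l ?(ltW w0)// ler_nat.
have val_prod (x : 'rV[posnat]_k.+1) :
    (\prod_j val (x ord0 j))%:R = \prod_j (val (x ord0 j))%:R :> R.
  by rewrite rmorph_prod.
have expR_prod (f : 'I_k.+1 -> R) : \prod_j expR (w * f j) = expR (w * \sum_j f j).
  by rewrite -expR_sum mulr_sumr.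
have UpsE M : (M < Bd)%N -> Upsilon h (expR (w * M%:R)) =
    \sum_(x <- s | x \in hyperbolic (expR (w * M%:R))) h x.
  move=> MBd; rewrite /Upsilon (fsum_seq _ (cube_uniq k.+1 B))//.
  exact: hyperbolic_sub_cube (MB _ (ltnW MBd)).
have boundT M : (M < Bd)%N -> T M <= 2 ^+ k * (Cb * M.+1%:R ^+ k.+1 * expR (alpha * (w * M%:R))).
  move=> MBd; rewrite TPhi//; apply: (le_trans (ler_norm _)).
  rewrite -[2%:R]/(1 + 1 : R); apply: (iter_nab_bound _ _ (bmono _ _ Cb0 (ltW alpha0)) _ MBd) => //.
  move=> m mB; rewrite /Phi (@expand m.+1)// [_ * _ ^+ _]mulrC -mulrA.
  apply: card_le => [|n /eqP nm]; first by rewrite mulr_ge0 ?expR_ge0.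
  have nB j : expR (w * (n j)%:R) <= B%:R.
    by apply: MB; apply: leq_trans mB; exact: ltnW.
  rewrite (sum_step h cellP nB) ger0_norm ?sum_box_ge0//.
  apply: (le_trans (CbP h Hh _ (gridvec_ge1 _ (ltW w0)))).
  by rewrite ler_wpM2l// vprod_gridvec nm -expRM mulrC.
have boundH M : (M < Bd)%N -> `|Hh' M| <= C1 * M.+1%:R ^+ k.+1 * expR ((alpha - eta) * (w * M%:R)).
  move=> MBd; rewrite /Hh' (@expand M.+1)// [_ * _ ^+ _]mulrC -mulrA.
  apply: card_le => [|n /eqP nM]; first by rewrite mulr_ge0 ?expR_ge0.
  by have := mixedB M n MBd; rewrite nM.
have Cmono A M e : 0 <= A -> A <= C -> A * M.+1%:R ^+ k.+1 * expR e <= C * M.+1%:R ^+ k.+1 * expR e.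
  by move=> A0 AC; rewrite ler_wpM2r ?expR_ge0// ler_wpM2r// exprn_ge0.
exists T, (fun M => expR (- (alpha * w * M%:R)) * u M); split.
- move=> M MBd; apply/andP; split.
    by apply: sumr_ge0 => x _; rewrite mulr_ge0.
  rewrite /= UpsE// big_mkcond [leRHS]big_mkcond; apply: ler_sum => x _ /=.
  rewrite /step; case: leqP => [aM|_]; last by rewrite mulr0; case: ifP.
  rewrite mulr1 ifT// inE /hyperbolic /= val_prod.
  apply: (@le_trans _ _ (\prod_j expR (w * (a x j)%:R))).
    by apply: ler_prod => j _; rewrite ler0n -cellP leqnn.
  by rewrite expR_prod ler_expR ler_pM2l// -natr_sum ler_nat.
- move=> M MBd; rewrite /= UpsE; last by rewrite (leq_ltn_trans _ MBd)// leq_addr.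
  rewrite big_mkcond [leRHS]big_mkcond; apply: ler_sum => x _ /=.
  case: ifPn => [/set_mem xM|_]; last by rewrite mulr_ge0.
  suff aM : (\sum_j a x j <= M + k.+1)%N by rewrite /step aM mulr1.
  (* The entries of a cell of index a exceed e^(w (a - 1)) for a >= 1, and are at least 1 for a = 0.
     So the index sum exceeds [M] by at most one per coordinate. *)
  have : \prod_j expR (w * ((a x j)%:R - 1)) <= expR (w * M%:R).
    apply: le_trans xM; rewrite val_prod; apply: ler_prod => j _.
    rewrite expR_ge0 /=; case aE : (a x j) => [|m].
      rewrite (@le_trans _ _ 1)//; last by rewrite ler1n (valP (x ord0 j)).
      by rewrite -[leRHS]expR0 ler_expR (_ : _ * _ = - w) ?oppr_le0 ?ltW//; ring.
    rewrite -natr1 addrK ltW// ltNge -cellP -/(a x j) aE -ltnNge//.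
  rewrite expR_prod ler_expR ler_pM2l// sumrB sumr_const card_ord -natr_sum.
  by rewrite lerBlDr -natrD ler_nat.
- move=> M MBd; apply: (le_trans (boundT M MBd)); rewrite !mulrA.
  apply: Cmono; first by rewrite mulr_ge0// exprn_ge0.
  by rewrite /C mulrDr -addrA addrCA lerDl addr_ge0// mulr_ge0// exprn_ge0.
- move=> M MBd; rewrite (eq_iter_nab k.+1 t TPhi)// iter_nabC.
  rewrite (eq_iter_nab k 1 PhiH)//.
  apply: (@le_trans _ _ (2 ^+ k * (C1 * M.+1%:R ^+ k.+1 * expR ((alpha - eta) * (w * M%:R))))).
    rewrite -[2%:R]/(1 + 1 : R).
    apply: (iter_nab_bound _ _ (bmono _ _ C10 _) _ MBd) => //.
    by rewrite subr_ge0.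
  rewrite !mulrA; apply: Cmono; first by rewrite mulr_ge0// exprn_ge0.
  by rewrite /C mulrDr -addrA lerDl addr_ge0// mulr_ge0// exprn_ge0.
- split => M MBd.
    rewrite (eq_iter_nab k t TPhi)// iter_nabC.
    apply: (@eq_iter_nab _ _ _ _ _ Bd) => // m mB; rewrite -/u.
    by rewrite mulrA -expRD subrr expR0 mul1r.
  (* Telescoping makes the normalised [u M] the sum of [g] over all index sums up to [M]. On the
     cube of indices at most b = M / k.+1 the sum factorises and telescopes to a single box sum,
     given by (I). Outside, some index exceeds b and the mixed difference is small. *)
  pose g (n : {ffun 'I_k.+1 -> 'I_M.+1}) :=
    expR (- (alpha * w * (\sum_j n j)%:R)) * mixed_diff cell t s h (fun j => n j : nat).
  have zE : expR (- (alpha * w * M%:R)) * u M =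
      \sum_(n : {ffun 'I_k.+1 -> 'I_M.+1} | (\sum_j n j <= M)%N) g n.
    rewrite -sum_nab.
    rewrite (eq_bigr (fun m : 'I_M.+1 => \sum_(n : {ffun 'I_k.+1 -> 'I_M.+1} |
        (\sum_j n j)%N == m) g n)); last first.
      move=> m _; have mB : (m < Bd)%N by apply: leq_trans MBd; exact: ltn_ord.
      rewrite -/t -[nab t u]/(iter k.+1 (nab t) Phi) PhiH//.
      rewrite /Hh' (@expand M.+1)// mulr_sumr; apply: eq_bigr => n /eqP nm.
      by rewrite /g nm.
    rewrite (eq_bigr (fun m : 'I_M.+1 => \sum_(n : {ffun 'I_k.+1 -> 'I_M.+1})
      if (\sum_j n j)%N == m then g n else 0)); last by move=> m _; rewrite big_mkcond.
    rewrite exchange_big [RHS]big_mkcond; apply: eq_bigr => n _ /=.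
    case: leqP => nM; last first.
      rewrite big1// => m _; case: eqP => // nm.
      by move: nM; rewrite nm ltnNge -ltnS ltn_ord.
    by rewrite -big_mkcond (big_pred1 (Ordinal (nM : _ < M.+1)%N)).
  set b := (M %/ k.+1)%N; have bM : (k.+1 * b <= M)%N by rewrite mulnC leq_trunc_div.
  pose P (n : {ffun 'I_k.+1 -> 'I_M.+1}) := [forall j, (n j <= b)%N].
  rewrite zE (bigID P) /= addrAC; apply: (le_trans (ler_normD _ _)).
  set E := expR (- (eta * (w * b%:R))).
  have boxE : \sum_(n : {ffun 'I_k.+1 -> 'I_M.+1} | (\sum_j n j <= M)%N && P n) g n =
      expR (- (alpha * (w * (k.+1 * b)%:R))) * \sum_(x \in box (gridvec w (fun _ : 'I_k.+1 => b))) h x.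
    have bB j : expR (w * ((fun _ : 'I_k.+1 => b) j)%:R) <= B%:R.
      by apply: MB; apply: leq_trans (ltnW MBd); exact: leq_div.
    have bM1 : (b < M.+1)%N by rewrite ltnS leq_div.
    rewrite -(sum_step h cellP bB) mulr_sumr.
    rewrite (eq_bigl (fun n => n \in ffun_on [pred i : 'I_M.+1 | (i <= b)%N])); last first.
      move=> n; apply/andP/ffun_onP => [[_ /forallP nb] j|nb]; first exact: nb.
      split; last by apply/forallP.
      apply: leq_trans bM; rewrite -[X in (_ <= X * _)%N]card_ord -sum_nat_const.
      by apply: leq_sum => j _; exact: nb.
    rewrite (eq_bigr (fun n : {ffun 'I_k.+1 -> 'I_M.+1} => \sum_(x <- s) h x * \prod_j
       (expR (- (alpha * w * (n j)%:R)) * nab t (step (a x j)) (n j)))); last first.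
      move=> n _; rewrite /g /mixed_diff mulr_sumr; apply: eq_bigr => x _.
      rewrite mulrCA big_split /= -expR_sum; congr (_ * (expR _ * _)).
      by rewrite sumrN -mulr_sumr natr_sum.
    rewrite exchange_big /=; apply: eq_bigr => x _.
    rewrite -mulr_sumr mulrCA; congr (_ * _).
    rewrite -(bigA_distr_big _ (fun j (i : 'I_M.+1) =>
      expR (- (alpha * w * i%:R)) * nab t (step (a x j)) i)).
    rewrite (eq_bigr (fun j => expR (- (alpha * w * b%:R)) * step (a x j) b)).
      rewrite big_split /= prodr_const card_ord -expRM_natl natrM; congr (expR _ * _).
      by ring.
    move=> j _; rewrite -sum_nab -/t.
    by rewrite (big_ord_widen M.+1 (fun i => expR (- (alpha * w * i%:R)) * nab t (step (a x j)) i)).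
  have boxB : `|\sum_(n : {ffun 'I_k.+1 -> 'I_M.+1} | (\sum_j n j <= M)%N && P n) g n
      - ch h| <= `|C0| * E.
    rewrite boxE; set X := gridvec w _.
    have X1 : ge1_vec X by apply: gridvec_ge1; exact: ltW.
    have := C0P h Hh X X1; set S := \sum_(x \in _) _.
    have -> : vprod X `^ alpha = expR (alpha * (w * (k.+1 * b)%:R)).
      by rewrite vprod_gridvec -expRM mulrC sum_nat_const card_ord.
    set V := expR _ => SX.
    have -> : expR (- (alpha * (w * (k.+1 * b)%:R))) = V^-1 by rewrite expRN.
    have V0 : 0 < V by exact: expR_gt0.
    have -> : V^-1 * S - ch h = V^-1 * (S - ch h * V) by rewrite mulrBr mulrCA mulVf ?gt_eqF// mulr1.
    rewrite normrM gtr0_norm ?invr_gt0// mulrC ler_pdivrMr//.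
    apply: (le_trans SX).
    apply: (@le_trans _ _ (`|C0| * (V * vmin X `^ (- delta)))).
      by rewrite ler_wpM2r ?ler_norm// mulr_ge0 ?powR_ge0// ltW.
    rewrite -mulrA ler_wpM2l// mulrC ler_wpM2r ?(ltW V0)//.
    apply: (@le_trans _ _ (expR (w * b%:R) `^ (- delta))).
      apply: powRN_lel; rewrite ?(ltW delta0) ?expR_gt0//.
      by apply: vmin_ge => j; rewrite mxE.
    rewrite -expRM ler_expR mulrN lerN2 [leRHS]mulrC ler_wpM2r// mulr_ge0//.
    exact: ltW.
  have restB : `|\sum_(n : {ffun 'I_k.+1 -> 'I_M.+1} | (\sum_j n j <= M)%N && ~~ P n) g n|
      <= M.+1%:R ^+ k.+1 * (C1 * E).
    apply: card_le => [|n /andP[_]]; first by rewrite mulr_ge0 ?expR_ge0.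
    rewrite negb_forall => /existsP[j]; rewrite -ltnNge => bn.
    rewrite /g normrM ger0_norm ?expR_ge0//.
    apply: (le_trans (ler_wpM2l (expR_ge0 _) (mixedB M n MBd))).
    rewrite mulrCA ler_wpM2l// -expRD ler_expR.
    rewrite (_ : _ + _ = - (eta * (w * (\sum_j n j)%:R))); last by ring.
    rewrite lerN2 ler_pM2l// ler_pM2l// ler_nat (leq_trans (ltnW bn))//.
    by rewrite (bigD1 j)//= leq_addr.
  apply: (le_trans (lerD boxB restB)).
  have M1 : 1 <= M.+1%:R ^+ k.+1 :> R by rewrite exprn_ege1// ler1n.
  rewrite mulrA -mulrDl ler_wpM2r ?expR_ge0//.
  have : 1 <= 2 ^+ k :> R by rewrite exprn_ege1// ler1n.
  have : 0 <= `|C0| by [].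
  rewrite /C; move: M1 C10 Cb0; set X := _ ^+ k.+1; set Y := _ ^+ k; set Z := `|C0|.
  move=> X1 ? ? ? Y1.
  have ? : Z <= Z * X by rewrite ler_peMr.
  have ? : C1 * X <= Y * (C1 * X) by rewrite ler_peMl// mulr_ge0// (le_trans ler01).
  have ? : 0 <= Y * (Cb * X) by rewrite !mulr_ge0// (le_trans ler01).
  lra.
Qed.

End GridSequences.

(** * Newton expansion, interpolation and limits *)

Section ForwardDifference.
Context {R : realType}.

Definition fwd (u : nat -> R) (M : nat) : R := u M.+1 - u M.

(** The remainder of order K + 1 grows from [m] to [m.+1] by the remainder of order K of [fwd y] at
    [m]. *)
Lemma newton_expansion K (y : nat -> R) e Q : 0 <= e ->
  (forall m, (m <= Q)%N -> `|iter K fwd y m| <= e) ->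
  forall m, (m <= Q)%N ->
  `|y m - \sum_(i < K) 'C(m, i)%:R * iter i fwd y 0%N| <= m%:R ^+ K * e.
Proof.
move=> e0; elim: K y => [|K IH] y ye.
  by move=> m mQ; rewrite big_ord0 subr0 mul1r; exact: ye.
have {}IH := IH (fwd y) _.
elim=> [_|m IHm mQ].
  rewrite big_ord_recl big1 => [|i _]; first by rewrite bin0 mul1r addr0 subrr normr0 mulr_ge0.
  by rewrite bin0n mul0r.
have -> : y m.+1 - \sum_(i < K.+1) 'C(m.+1, i)%:R * iter i fwd y 0%N =
    (y m - \sum_(i < K.+1) 'C(m, i)%:R * iter i fwd y 0%N) +
    (fwd y m - \sum_(i < K) 'C(m, i)%:R * iter i fwd (fwd y) 0%N).
  rewrite !big_ord_recl /= !bin0.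
  rewrite (eq_bigr (fun i : 'I_K => 'C(m, i.+1)%:R * iter i.+1 fwd y 0%N +
      'C(m, i)%:R * iter i fwd (fwd y) 0%N)); last first.
    by move=> i _; rewrite /bump /= add1n binS natrD mulrDl -iterSr.
  by rewrite big_split /= /fwd; ring.
apply: (le_trans (ler_normD _ _)).
apply: (@le_trans _ _ (m%:R ^+ K.+1 * e + m%:R ^+ K * e)).
  apply: lerD; first by apply: IHm; exact: ltnW.
  by apply: IH; [move=> l lQ; rewrite -iterSr; exact: ye|exact: ltnW].
rewrite -mulrDl ler_wpM2r// exprS -{2}[_ ^+ K]mul1r -mulrDl natr1 exprS.
by rewrite ler_wpM2l// lerXn2r// ?nnegrE// ler_nat.
Qed.

(** The weight turns the twisted differences into ordinary ones. The argument moves by [n] because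
    [nab] looks backward and [fwd] forward. *)
Lemma iter_fwd_exp n a (T : nat -> R) M :
  iter n fwd (fun M => expR (- (a * M%:R)) * T M) M =
  expR (- (a * (M + n)%:R)) * iter n (nab (expR a)) T (M + n)%N.
Proof.
elim: n M => [|n IH] M; first by rewrite addn0.
rewrite iterS {1}/fwd !IH addSnnS addnS iterS {3}/nab mulrBr; congr (_ - _).
rewrite mulrA -expRD; congr (expR _ * _); rewrite -natr1; ring.
Qed.

End ForwardDifference.

Section Polynomials.
Context {R : realType}.

(* Lagrange interpolation at the nodes [1, ..., K + 1]. *)
Lemma coef_bound_nodes K : exists2 C : R, 0 <= C & forall (p : {poly R}) (A : R),
  (size p <= K.+1)%N -> (forall i : nat, (i <= K)%N -> `|p.[i.+1%:R]| <= A) ->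
  forall j, `|p`_j| <= C * A.
Proof.
pose l (i : 'I_K.+1) : {poly R} := \prod_(m < K.+1 | m != i)
  ((i.+1%:R - m.+1%:R)^-1 *: ('X - (m.+1%:R)%:P)).
have lE (i m : 'I_K.+1) : (l i).[m.+1%:R] = (m == i)%:R.
  rewrite /l horner_prod; case: eqP => [->|/eqP mi].
    apply: big1 => m' mi; rewrite !hornerE mulVf// subr_eq0 eqr_nat eqSS eq_sym.
    exact: mi.
  by rewrite (bigD1 m)//= !hornerE subrr mulr0 mul0r.
have lsz i : (size (l i) <= K.+1)%N.
  have szf (m : 'I_K.+1) : (size (((i.+1%:R - m.+1%:R)^-1 : R) *: ('X - (m.+1%:R)%:P)) <= 2)%N.
    by rewrite (leq_trans (size_scale_leq _ _))// size_XsubC.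
  apply: (leq_trans (size_poly_prod_leq _ _)).
  apply: (@leq_trans ((\sum_(m < K.+1 | m != i) 2).+1 - #|[pred m : 'I_K.+1 | m != i]|)%N).
    by rewrite leq_sub2r// ltnS; apply: leq_sum => m _; exact: szf.
  rewrite sum_nat_const; have -> : #|[pred m : 'I_K.+1 | m != i]| = K.
    by have := cardC1 i; rewrite card_ord.
  by rewrite muln2 -addnn subSn ?leq_addr// addnK.
exists (\sum_(i < K.+1) \sum_(j < K.+1) `|(l i)`_j|).
  by apply: sumr_ge0 => i _; apply: sumr_ge0.
move=> p A sp pA j.
have pE : p = \sum_(i < K.+1) p.[i.+1%:R] *: l i.
  apply/subr0_eq.
  apply: (@roots_geq_poly_eq0 R _ [seq (val i).+1%:R | i <- enum 'I_K.+1]).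
  - apply/allP => _ /mapP[i _ ->]; rewrite rootE hornerD hornerN horner_sum.
    rewrite (bigD1 i)//= big1 => [|m mi].
      by rewrite addr0 hornerZ lE eqxx mulr1 subrr.
    by rewrite hornerZ lE eq_sym (negbTE mi) mulr0.
  - rewrite map_inj_uniq ?enum_uniq// => i i' /eqP.
    by rewrite eqr_nat eqSS => /eqP/val_inj.
  rewrite size_map size_enum_ord.
  rewrite (leq_trans (size_polyD _ _))// geq_max sp size_polyN.
  apply: (leq_trans (size_sum _ _ _)); apply/bigmax_leqP => i _.
  exact: (leq_trans (size_scale_leq _ _)).
have A0 : 0 <= A by apply: le_trans (pA 0%N _).
have [jK|Kj] := ltnP j K.+1; last first.
  rewrite nth_default ?(leq_trans sp)// normr0 mulr_ge0//.
  by apply: sumr_ge0 => i _; apply: sumr_ge0.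
rewrite {1}pE coef_sum mulr_suml; apply: (le_trans (ler_norm_sum _ _ _)).
apply: ler_sum => i _; rewrite coefZ normrM mulrC ler_pM//; last first.
  by apply: pA; rewrite -ltnS.
by rewrite (bigD1 (Ordinal jK))//= lerDl sumr_ge0.
Qed.

(** Substituting n X for X brings the nodes back to 1, ..., K + 1, and for n >= 1 it does not
    decrease the coefficients in absolute value. So one constant serves for all windows. *)
Lemma coef_bound_scaled K : exists2 C : R, 0 <= C &
  forall (p : {poly R}) (A : R) (n : nat),
  (size p <= K.+1)%N -> (0 < n)%N ->
  (forall i : nat, (i <= K)%N -> `|p.[(i.+1 * n)%:R]| <= A) ->
  forall j, `|p`_j| <= C * A.
Proof.
have [C C0 CP] := coef_bound_nodes K; exists C => // p A n sp n0 pA j.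
pose p' := \poly_(j < K.+1) (p`_j * n%:R ^+ j).
have := CP p' A (size_poly _ _) _ j; rewrite coef_poly.
have A0 : 0 <= A by apply: le_trans (pA 0%N _).
case: ltnP => jK H; last first.
  by rewrite nth_default ?(leq_trans sp)// normr0 mulr_ge0.
have n1 : 1 <= n%:R ^+ j :> R by rewrite exprn_ege1// ler1n.
apply: (@le_trans _ _ (`|p`_j * n%:R ^+ j|)).
  by rewrite normrM [X in _ * X]ger0_norm ?(le_trans ler01)// ler_peMr.
apply: H => i iK; have := pA i iK.
rewrite (horner_coef_wide _ sp) horner_poly; congr (`|_| <= _).
by apply: eq_bigr => m _; rewrite natrM exprMn -mulrA [n%:R ^+ m * _]mulrC.
Qed.

Lemma horner_lipschitz K (p : {poly R}) (A B x y : R) : (size p <= K.+1)%N ->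
  (forall j, `|p`_j| <= A) -> 1 <= B -> 0 <= x <= B -> 0 <= y <= B ->
  `|p.[x] - p.[y]| <= K.+1%:R ^+ 2 * B ^+ K * A * `|x - y|.
Proof.
move=> sp pA B1 /andP[x0 xB] /andP[y0 yB].
have A0 : 0 <= A by apply: le_trans (pA 0%N).
have B0 : 0 <= B by rewrite (le_trans ler01).
rewrite !(horner_coef_wide _ sp) -sumrB.
apply: (le_trans (ler_norm_sum _ _ _)).
apply: (@le_trans _ _ (\sum_(i < K.+1) (K.+1%:R * B ^+ K * A * `|x - y|))); last first.
  by rewrite sumr_const card_ord expr2 -!mulrA !mulr_natl.
apply: ler_sum => i _; rewrite -mulrBr normrM subrXX normrM.
rewrite [leLHS]mulrCA [leRHS]mulrC ler_wpM2l// [leRHS]mulrC ler_pM//.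
apply: (le_trans (ler_norm_sum _ _ _)).
apply: (@le_trans _ _ (\sum_(j < i) B ^+ K)).
  apply: ler_sum => j _; rewrite normrM !normrX !ger0_norm//.
  apply: (@le_trans _ _ (B ^+ (i.-1 - j) * B ^+ j)).
    by apply: ler_pM; rewrite ?exprn_ge0// lerXn2r// nnegrE.
  rewrite -exprD ler_weXn2l//.
  have ji := ltn_ord j; have iK := ltn_ord i.
  apply: (@leq_trans i.-1); first by rewrite subnK// -ltnS (ltn_predK ji).
  by apply: leq_trans (leq_pred _) _; rewrite -ltnS.
rewrite sumr_const card_ord -[leLHS]mulr_natl ler_wpM2r ?exprn_ge0// ler_nat.
exact: ltnW.
Qed.

End Polynomials.

Section Limits.
Context {R : realType}.

(** With [r n] the tail of the geometric series, the intervals from u n - r n to u n + r n are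
    nested, and the limit is the supremum of their left ends. *)
Lemma geometric_limit (u : nat -> R) C q : 0 <= C -> 0 < q < 1 ->
  (forall n, `|u n.+1 - u n| <= C * q ^+ n) ->
  exists l, forall n, `|u n - l| <= C / (1 - q) * q ^+ n.
Proof.
move=> C0 /andP[q0 q1] uC; pose r n := C / (1 - q) * q ^+ n.
have q1' : 0 < 1 - q by rewrite subr_gt0.
have r0 n : 0 <= r n by rewrite mulr_ge0 ?exprn_ge0 ?divr_ge0 ?(ltW q0) ?(ltW q1').
have rS n : r n = r n.+1 + C * q ^+ n.
  by rewrite /r exprS; field; rewrite gt_eqF.
have lo n m : u n - r n <= u (n + m)%N - r (n + m)%N.
  elim: m => [|m IH]; first by rewrite addn0.
  apply: (le_trans IH); rewrite addnS (rS (n + m)%N).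
  have := uC (n + m)%N; rewrite ler_norml => /andP[]; lra.
have hi n m : u (n + m)%N + r (n + m)%N <= u n + r n.
  elim: m => [|m IH]; first by rewrite addn0.
  apply: le_trans IH; rewrite addnS (rS (n + m)%N).
  have := uC (n + m)%N; rewrite ler_norml => /andP[]; lra.
have lohi n m : u n - r n <= u m + r m.
  have := lo n m; have := hi m n; rewrite addnC; have := r0 (n + m)%N; lra.
pose E := [set u n - r n | n in [set: nat]].
have E0 : E !=set0 by exists (u 0%N - r 0%N), 0%N.
exists (sup E) => n; rewrite ler_distlC; apply/andP; split.
  apply: ub_le_sup; last by exists n.
  by exists (u n + r n) => _ [m _ <-]; exact: lohi.
by apply: sup_le_ub => // _ [m _ <-]; exact: lohi.
Qed.

(** Exponential decay at an unspecified rate: the error terms decay at different rates, and only the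
    existence of a common one matters. *)
Definition expdec (e : nat -> R) :=
  exists2 b, 0 < b & exists2 C, 0 <= C & forall n, e n <= C * expR (- (b * n%:R)).

Lemma expdecD e e' : expdec e -> expdec e' -> expdec (fun n => e n + e' n).
Proof.
move=> [b b0 [C C0 eC]] [b' b'0 [C' C'0 eC']].
exists (Num.min b b'); first by rewrite lt_min b0.
exists (C + C'); first by rewrite addr_ge0.
move=> n; rewrite mulrDl; apply: lerD.
  apply: (le_trans (eC n)); rewrite ler_wpM2l// ler_expR lerN2 ler_wpM2r//.
  by rewrite ge_min lexx.
apply: (le_trans (eC' n)); rewrite ler_wpM2l// ler_expR lerN2 ler_wpM2r//.
by rewrite ge_min lexx orbT.
Qed.

Lemma expdec_le e e' : (forall n, e n <= e' n) -> expdec e' -> expdec e.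
Proof.
move=> ee [b b0 [C C0 eC]]; exists b => //; exists C => // n.
exact: le_trans (eC n).
Qed.

Lemma expdecZ a e : 0 <= a -> expdec e -> expdec (fun n => a * e n).
Proof.
move=> a0 [b b0 [C C0 eC]]; exists b => //; exists (a * C); first by rewrite mulr_ge0.
by move=> n; rewrite -mulrA ler_wpM2l.
Qed.

Lemma expdec_poly m b : 0 < b ->
  expdec (fun n => n.+1%:R ^+ m * expR (- (b * n%:R))).
Proof.
move=> b0; exists (b / 2); first by rewrite divr_gt0.
(* The m-th power of n + 1 may use up half of the rate; [m.+1] also covers m = 0. *)
pose B := b / 2 / m.+1%:R.
have B0 : 0 < B by rewrite !divr_gt0.
exists ((B^-1 * expR B) ^+ m); first by rewrite exprn_ge0// mulr_ge0 ?expR_ge0// invr_ge0 ltW.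
move=> n.
have n1 : n.+1%:R <= B^-1 * expR B * expR (B * n%:R).
  rewrite -mulrA -expRD mulrC ler_pdivlMr//.
  apply: le_trans (expR_ge1Dx _); rewrite -natr1; nra.
apply: (@le_trans _ _ ((B^-1 * expR B * expR (B * n%:R)) ^+ m * expR (- (b * n%:R)))).
  by rewrite ler_wpM2r ?expR_ge0// lerXn2r// nnegrE// !mulr_ge0 ?expR_ge0// invr_ge0 ltW.
set X := B^-1 * _; rewrite exprMn -[leLHS]mulrA ler_wpM2l//.
  by rewrite exprn_ge0// mulr_ge0 ?expR_ge0// invr_ge0 ltW.
rewrite -expRM_natl -expRD ler_expR.
have : m%:R * (B * n%:R) <= b / 2 * n%:R.
  rewrite mulrA ler_wpM2r// /B mulrCA ger_pMr ?divr_gt0//.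
  by rewrite ler_pdivrMr// mul1r ler_nat.
lra.
Qed.

End Limits.

Section WindowTools.
Context {R : realType}.

(** Newton's form as a polynomial in the logarithmic variable (M0 + m) / q: [f i] is the i-th
    falling factorial of q X - M0, with top coefficient q^i. Hence the K-th difference must be known
    up to o(q^-K). *)
Lemma newton_poly K (d : nat -> R) (q M0 : R) : q != 0 ->
  exists p : {poly R}, [/\ (size p <= K.+1)%N, p`_K = d K * q ^+ K / K`!%:R &
    forall m : nat, p.[(M0 + m%:R) / q] = \sum_(i < K.+1) 'C(m, i)%:R * d i].
Proof.
move=> q0; pose f i : {poly R} := \prod_(l < i) (q *: 'X - (M0 + (l : nat)%:R)%:P).
have fP i : (size (f i) <= i.+1)%N /\ (f i)`_i = q ^+ i.
  elim: i => [|i [sz cf]]; first by rewrite /f big_ord0 size_poly1 coef1.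
  rewrite /f big_ord_recr /= -/(f i); split.
    apply: (leq_trans (size_polyMleq _ _)).
    have szl : (size (q *: 'X - (M0 + i%:R)%:P : {poly R})%R <= 2)%N.
      rewrite (leq_trans (size_polyD _ _))// geq_max size_polyN.
      rewrite (leq_trans (size_scale_leq _ _)) ?size_polyX//=.
      by rewrite (leq_trans (size_polyC_leq1 _)).
    by rewrite -subn1 leq_subLR (leq_trans (leq_add sz szl))// addn2 add1n.
  rewrite mulrBr coefB coefMC -scalerAr coefZ coefMX /= cf.
  by rewrite (nth_default _ sz) mul0r subr0 exprS.
have fE i m : (f i).[(M0 + m%:R) / q] = (m ^_ i)%:R.
  elim: i => [|i IH]; first by rewrite /f big_ord0 hornerC ffactn0.
  rewrite /f big_ord_recr /= -/(f i) hornerM IH ffactnSr natrM.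
  rewrite hornerD hornerN hornerZ hornerX hornerC [q * _]mulrC divfK//.
  have [im|mi] := leqP i m; last by rewrite ffact_small// !mul0r.
  by rewrite natrB//; congr (_ * _); ring.
exists (\sum_(i < K.+1) (d i / i`!%:R) *: f i); split.
- apply: (leq_trans (size_sum _ _ _)); apply/bigmax_leqP => i _.
  apply: (leq_trans (size_scale_leq _ _)); apply: leq_trans (fP i).1 _.
  exact: ltn_ord.
- rewrite coef_sum big_ord_recr /= big1 => [|i _].
    by rewrite add0r coefZ (fP K).2 mulrAC.
  by rewrite coefZ nth_default ?mulr0//; apply: leq_trans (fP i).1 _; exact: ltn_ord.
- move=> m; rewrite horner_sum; apply: eq_bigr => i _.
  rewrite hornerZ fE -bin_ffact natrM; field.
  by rewrite pnatr_eq0 -lt0n fact_gt0.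
Qed.

Lemma iter_fwd_shift n (u : nat -> R) M0 m :
  iter n fwd (fun m => u (M0 + m)%N) m = iter n fwd u (M0 + m)%N.
Proof. by elim: n m => // n IH m; rewrite !iterS /fwd !IH addnS. Qed.

(** For constant z = cc each difference multiplies by 1 - e^(-a) exactly; a deviation [eps] at most
    doubles each time. *)
Lemma leading_difference (a cc eps : R) (z : nat -> R) M0 K : 0 <= a ->
  (forall m, (M0 <= m <= M0 + K)%N -> `|z m - cc| <= eps) ->
  `|expR (- (a * (M0 + K)%:R)) *
      iter K (nab 1) (fun m => expR (a * m%:R) * z m) (M0 + K)%N
    - cc * (1 - expR (- a)) ^+ K| <= 2 ^+ K * eps.
Proof.
move=> a0 zcc; set v := fun m => _; set tau := expR (- a).
have tau0 : 0 <= tau by exact: expR_ge0.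
have tau1 : tau <= 1 by rewrite -expR0 ler_expR oppr_le0.
suff : forall j m, (j <= K)%N -> (M0 + j <= m <= M0 + K)%N ->
    `|expR (- (a * m%:R)) * iter j (nab 1) v m - cc * (1 - tau) ^+ j| <= 2 ^+ j * eps.
  by apply => //; rewrite !leqnn.
elim=> [|j IH] m jK /andP[jm mK].
  rewrite !expr0 mulr1 mul1r /v mulrA -expRD addNr expR0 mul1r.
  by apply: zcc; rewrite mK -(addn0 M0) jm.
case: m jm mK => [|m]; first by rewrite addnS.
rewrite addnS ltnS => jm mK.
have b1 := IH m.+1 (ltnW jK); have b2 := IH m (ltnW jK).
have {}b1 := b1 _; have {}b2 := b2 _.
rewrite iterS /nab mul1r.
set X := expR (- (a * m.+1%:R)) * iter j (nab 1) v m.+1.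
set Y := expR (- (a * m%:R)) * iter j (nab 1) v m.
have -> : expR (- (a * m.+1%:R)) * (iter j (nab 1) v m.+1 - iter j (nab 1) v m) = X - tau * Y.
  rewrite mulrBr /Y mulrA -expRD; congr (_ - expR _ * _); rewrite -natr1; ring.
have -> : X - tau * Y - cc * (1 - tau) ^+ j.+1 =
    (X - cc * (1 - tau) ^+ j) - tau * (Y - cc * (1 - tau) ^+ j).
  by rewrite exprS; ring.
apply: (le_trans (ler_normB _ _)); rewrite normrM (ger0_norm tau0) exprS -mulrA mulrDl mul1r.
apply: lerD; first by apply: b1; rewrite mK (leq_trans jm).
apply: (@le_trans _ _ `|Y - cc * (1 - tau) ^+ j|); first by rewrite ler_piMl.
by apply: b2; rewrite jm ltnW.
Qed.

Lemma exprn_lipschitz K (B x y : R) : 1 <= B -> 0 <= x <= B -> 0 <= y <= B ->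
  `|x ^+ K - y ^+ K| <= K.+1%:R ^+ 2 * B ^+ K * `|x - y|.
Proof.
move=> B1 xB yB.
have := @horner_lipschitz R K 'X^K 1 B x y _ _ B1 xB yB.
rewrite !hornerXn mulr1 size_polyXn; apply=> // j.
by rewrite coefXn; case: eqP; rewrite ?normr1 ?normr0.
Qed.

Lemma one_sub_expR (x : R) : 0 <= x -> x - x ^+ 2 <= 1 - expR (- x) <= x.
Proof.
move=> x0; have := expR_ge1Dx (- x); have := expR_ge1Dx x.
have := expR_gt0 (- x); have : expR x * expR (- x) = 1 by rewrite -expRD subrr expR0.
set e := expR x; set e' := expR (- x) => ee e'0 h1 h2; apply/andP; split; nra.
Qed.

Lemma expR_sub1 (x : R) : 0 <= x -> expR x - 1 <= x * expR x.
Proof.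
move=> x0; have := expR_ge1Dx (- x).
have := expR_gt0 x; have : expR x * expR (- x) = 1 by rewrite -expRD subrr expR0.
set e := expR x; set e' := expR (- x) => ee e'0 h1; nra.
Qed.

End WindowTools.

Section GridApprox.
Context {R : realType}.
Implicit Types (alpha eta C cc : R) (k : nat) (U : R -> R).

(** The grid with w = 1 is fine enough for the order of magnitude. *)
Lemma grid_apriori alpha eta C k cc U L : 0 <= alpha -> 0 <= C ->
  {homo U : x y / x <= y} ->
  grid_approx alpha eta C k cc U -> 0 <= L ->
  U L <= C * (k.+3%:R ^+ k.+1 * expR (alpha * k.+2%:R)) *
    (1 + L) ^+ k.+1 * expR (alpha * L).
Proof.
move=> alpha0 C0 Umono gU L0; set M := (Num.truncn L).+1.
have ML : M%:R <= L + 1 by rewrite -natr1 lerD2r truncn_le.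
have LM : L <= M%:R by exact/ltW/truncnS_gt.
have lt1 : (0 : R) < (1 : R) <= (1 : R) by rewrite ltr01 lexx.
have [T [z [_ UT TC _ _]]] := gU 1 (M + k.+2)%N lt1.
apply: (@le_trans _ _ (U (1 * M%:R))); first by apply: Umono; rewrite mul1r.
apply: (le_trans (UT M _)); first by rewrite ltn_add2l.
apply: (le_trans (TC _ _)); first by rewrite ltn_add2l.
rewrite mul1r -!mulrA ler_wpM2l//.
have h1 : (M + k.+1).+1%:R <= k.+3%:R * (1 + L).
  rewrite -addnS natrD mulrDr mulr1.
  apply: (@le_trans _ _ (L + 1 + k.+2%:R)); first by rewrite lerD2r.
  rewrite -addrA nat1r addrC lerD2l ler_peMl// ler1n//.
have h2 : (M + k.+1)%:R <= L + k.+2%:R.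
  by rewrite natrD -[k.+2%:R]nat1r addrA lerD2r.
apply: (@le_trans _ _ ((k.+3%:R * (1 + L)) ^+ k.+1 * expR (alpha * (k.+2%:R + L)))).
  apply: ler_pM; rewrite ?exprn_ge0 ?expR_ge0//.
    by rewrite lerXn2r// nnegrE// mulr_ge0// addr_ge0.
  by rewrite ler_expR ler_wpM2l// addrC.
by rewrite exprMn mulrDr expRD le_eqVlt; apply/orP; left; apply/eqP; ring.
Qed.

End GridApprox.

(** * Polynomial approximation on windows *)

Section WindowScale.
Context {R : realType} {alpha eta C c cc : R} {k : nat} {U : R -> R}.
Context (eta0 : 0 < eta) (eta_alpha : eta <= alpha) (C0 : 0 <= C).
Context (cc0 : 0 <= cc) (ccc : cc <= c).
Context (Umono : {homo U : x y / x <= y}) (gU : grid_approx alpha eta C k cc U).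
Context {CK : R} (CK0 : 0 <= CK).
Context (CKP : forall (p : {poly R}) (A : R) (n : nat),
  (size p <= k.+1)%N -> (0 < n)%N ->
  (forall i : nat, (i <= k)%N -> `|p.[(i.+1 * n)%:R]| <= A) ->
  forall j, `|p`_j| <= CK * A).

(* The window is [N <= L <= (k + 1) (N + 1)] and [1 / q] is the mesh of the grid; the
   [win_*] quantities are error bounds in terms of [q] and [N] only. *)
Let A0 : R := C * (k.+3%:R ^+ k.+1 * expR (alpha * k.+2%:R)).
(** 2 k + 3 is (k + 1) + (k + 2): the end of the window, and room for the k + 2 grid steps by which
    the upper bound for [U] overshoots. [win_size] leaves further room for the difference of order k
    + 1. *)
Definition win_top (N : nat) : nat := ((k + k).+3 * N.+1)%N.
Definition win_size (q N : nat) : nat := (q * win_top N + k.+2)%N.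
Definition win_newton (q N : nat) : R :=
  (win_size q N)%:R ^+ k.+1 * (C * (win_size q N)%:R ^+ k.+1 * expR (- (eta * N%:R))).
Definition win_apriori (N : nat) : R := A0 * (1 + (win_top N)%:R) ^+ k.+1.
Definition win_lip (q N : nat) : R := k.+1%:R ^+ 2 * (win_top N)%:R ^+ k *
  (CK * (win_apriori N + win_newton q N)).
(** The terms come from Newton's remainder, from moving the argument of the polynomial to a grid
    point, and from the change of the weight e^(-alpha L) there. *)
Definition win_err (q N : nat) : R := win_newton q N
  + win_lip q N * k.+2%:R * q%:R^-1
  + (alpha + alpha * k.+2%:R * expR (alpha * k.+2%:R)) * q%:R^-1 * win_apriori N.
(** The first term is the error of the k-th difference, magnified by q^k through [newton_poly]; the
    second comes from replacing q (1 - e^(-alpha / q)) by [alpha]. *)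
Definition win_lead (q N : nat) : R :=
  2 ^+ k * (C * (win_size q N)%:R ^+ k.+1 * expR (eta - eta * N%:R / k.+1%:R)) * q%:R ^+ k
  + c * (k.+1%:R ^+ 2 * (1 + alpha) ^+ k * (alpha ^+ 2 * q%:R^-1)).

Let alpha0 : 0 < alpha. Proof. exact: lt_le_trans eta_alpha. Qed.

Lemma window_scale q N : (0 < q)%N -> (0 < N)%N ->
  exists p : {poly R}, [/\ (size p <= k.+1)%N,
    forall L, N%:R <= L <= (k.+1 * N.+1)%:R ->
      `|U L * expR (- (alpha * L)) - p.[L]| <= win_err q N &
    `|p`_k - cc * alpha ^+ k / k`!%:R| <= win_lead q N].
Proof.
move=> q0 N0; set w : R := q%:R^-1.
have qR0 : 0 < q%:R :> R by rewrite ltr0n.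
have w0 : 0 < w by rewrite invr_gt0.
have w1 : w <= 1 by rewrite invf_le1// ler1n.
have wq : w * q%:R = 1 by rewrite mulVf// gt_eqF.
set Lm := win_top N; set Bd := win_size q N.
set Mx := (q * Lm)%N; set M0 := (q * N)%N.
have BdE : Bd = (Mx + k.+2)%N by [].
have wM0 : w * M0%:R = N%:R by rewrite natrM mulrA wq mul1r.
have wMx : w * Mx%:R = Lm%:R by rewrite natrM mulrA wq mul1r.
have Lm1 : 1 <= Lm%:R :> R by rewrite ler1n muln_gt0.
have NLm : (N <= Lm)%N by apply: (leq_trans (leqnSn N)); exact: leq_pmull.
have M0Mx : (M0 <= Mx)%N by rewrite leq_mul2l NLm orbT.
have [|T [z [UT UTS TC TD [Tz zcc]]]] := @gU w Bd; first by rewrite w0.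
set a := alpha * w in TD Tz.
pose y M := expR (- (a * M%:R)) * T M.
pose y0 m := y (M0 + m)%N.
pose e := C * Bd%:R ^+ k.+1 * expR (- (eta * N%:R)).
have e0 : 0 <= e by rewrite !mulr_ge0 ?expR_ge0 ?exprn_ge0.
have y0d m : (m <= Mx - M0)%N -> `|iter k.+1 fwd y0 m| <= e.
  move=> mQ; rewrite (iter_fwd_shift _ y) iter_fwd_exp normrM ger0_norm ?expR_ge0//.
  set M := (M0 + m + k.+1)%N.
  have MM0 : (M0 <= M)%N by rewrite /M -addnA leq_addr.
  have MBd : (M < Bd)%N.
    by rewrite BdE /M [X in (_ < X)%N]addnS ltnS leq_add2r -(subnKC M0Mx) leq_add2l.
  rewrite -/a; apply: (le_trans (ler_wpM2l (expR_ge0 _) (TD _ MBd))).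
  rewrite mulrCA -expRD /e ler_pM ?expR_ge0 ?mulr_ge0 ?exprn_ge0//.
    by rewrite ler_wpM2l// lerXn2r ?nnegrE// ler_nat.
  rewrite ler_expR (_ : _ + _ = - (eta * (w * M%:R))); last by rewrite /a; ring.
  by rewrite lerN2 ler_pM2l// -wM0 ler_pM2l// ler_nat.
have yn := newton_expansion e0 y0d.
have [p [sp pk pE]] := newton_poly k (fun i => iter i fwd y0 0%N) M0%:R (lt0r_neq0 qR0).
have yp M : (M0 <= M <= Mx)%N -> `|y M - p.[w * M%:R]| <= win_newton q N.
  move=> /andP[MM0 MMx].
  have mQ : (M - M0 <= Mx - M0)%N by rewrite leq_sub2r.
  have := yn _ mQ; rewrite -pE /y0 subnKC//.
  rewrite (_ : (M0%:R + (M - M0)%:R) / q%:R = w * M%:R); last first.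
    by rewrite -natrD subnKC// mulrC.
  move=> h; apply: (le_trans h); rewrite /win_newton -/Bd -/e ler_wpM2r//.
  rewrite lerXn2r// ?nnegrE// ler_nat BdE.
  by rewrite (leq_trans mQ)// (leq_trans (leq_subr _ _))// leq_addr.
have A0_0 : 0 <= A0 by rewrite /A0 !mulr_ge0 ?exprn_ge0 ?expR_ge0.
have top0 : 0 <= 1 + Lm%:R :> R by rewrite addr_ge0.
have A1_0 : 0 <= win_apriori N by rewrite /win_apriori mulr_ge0 ?exprn_ge0.
have n0 : 0 <= win_newton q N by rewrite /win_newton mulr_ge0 ?exprn_ge0.
have yb M : (M <= Mx)%N -> 0 <= y M <= win_apriori N.
  move=> MMx; have MBd : (M < Bd)%N by rewrite BdE addnS ltnS (leq_trans MMx)// leq_addr.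
  have /andP[T0 TU] := UT M MBd.
  rewrite /y mulr_ge0 ?expR_ge0//=.
  have wM_ge0 : 0 <= w * M%:R by rewrite mulr_ge0// ltW.
  have := grid_apriori (ltW alpha0) C0 Umono gU wM_ge0.
  move=> /(le_trans TU) h; rewrite mulrC.
  apply: (le_trans (ler_wpM2r (expR_ge0 _) h)).
  rewrite -/A0 -[leLHS]mulrA -expRD
    (_ : alpha * (w * M%:R) + - (a * M%:R) = 0); last by rewrite /a; ring.
  rewrite expR0 mulr1 /win_apriori ler_wpM2l//.
  by rewrite lerXn2r ?nnegrE ?addr_ge0// lerD2l -wMx ler_pM2l// ler_nat.
(* The nodes N, 2 N, ..., (k + 1) N are grid points, where [p] is close to the bounded values of
   [y]. *)
have pc : forall j, `|p`_j| <= CK * (win_apriori N + win_newton q N).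
  apply: (CKP sp N0) => i ik.
  have Mr : (M0 <= q * (i.+1 * N) <= Mx)%N.
    rewrite /M0 /Mx !leq_pmul2l// leq_pmull//= /Lm /win_top leq_mul//.
    by rewrite ltnS (leq_trans ik)// (leq_trans (leq_addr k k))// !leqW.
  have -> : (i.+1 * N)%:R = w * (q * (i.+1 * N))%:R :> R by rewrite [in RHS]natrM mulrA wq mul1r.
  set M := (q * _)%N in Mr *.
  have := yp M Mr; have /andP[_ Mr2] := Mr; have /andP[y_0 yA] := yb M Mr2.
  rewrite ler_distlC ler_norml => /andP[h1 h2]; apply/andP; split; lra.
have pl x x' : 0 <= x <= Lm%:R -> 0 <= x' <= Lm%:R ->
    `|p.[x] - p.[x']| <= win_lip q N * `|x - x'|.
  exact: horner_lipschitz.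
have lip0 : 0 <= win_lip q N by rewrite /win_lip !mulr_ge0 ?exprn_ge0 ?addr_ge0.
exists p; split => //.
  move=> L /andP[NL LN].
  have L0 : 0 <= L by rewrite (le_trans _ NL).
  set M := Num.truncn (L * q%:R).
  have Lq0 : 0 <= L * q%:R by rewrite mulr_ge0.
  have ML : w * M%:R <= L by rewrite mulrC ler_pdivrMr// truncn_le.
  have LM : L <= w * M.+1%:R by rewrite mulrC ler_pdivlMr// ltW// truncnS_gt.
  have M0M : (M0 <= M)%N by rewrite truncn_ge_nat// natrM mulrC ler_wpM2r.
  have MMx : (M + k.+2 <= Mx)%N.
    have : (M <= q * (k.+1 * N.+1))%N.
      rewrite -(ler_nat R) natrM (@le_trans _ _ (L * q%:R)) ?truncn_le//.
      by rewrite mulrC ler_wpM2l.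
    move=> /leq_add -/(_ k.+2 (q * (k.+2 * N.+1))%N) h.
    have -> : Mx = (q * (k.+1 * N.+1) + q * (k.+2 * N.+1))%N.
      by rewrite -mulnDr -mulnDl addSn addnS addnS.
    by apply: h; rewrite mulnA [(q * _)%N]mulnC -mulnA leq_pmulr// muln_gt0 q0.
  have MMx' : (M <= Mx)%N by rewrite (leq_trans _ MMx)// leq_addr.
  have d1 : L - w * M%:R <= w.
    by move: LM; rewrite -natr1; lra.
  have d2 : 0 <= w * (M + k.+2)%:R - L <= k.+2%:R * w.
    have k1 : w <= w * k.+2%:R by rewrite ler_peMr ?ler1n// ltW.
    move: LM; rewrite natrD -[M.+1%:R]natr1 => LM; apply/andP; split; lra.
  (* One step rounds [L] up to the grid, and [k.+1] more pass from [U] to [T]. *)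
  set M' := (M + k.+2)%N in d2 MMx.
  have M'E : M' = (M.+1 + k.+1)%N by rewrite /M' addnS addSn.
  have MM' : (M <= M')%N by rewrite leq_addr.
  have in1 : 0 <= w * M%:R <= Lm%:R by rewrite mulr_ge0 ?(ltW w0)//= -wMx ler_pM2l// ler_nat.
  have in2 : 0 <= w * M'%:R <= Lm%:R by rewrite mulr_ge0 ?(ltW w0)//= -wMx ler_pM2l// ler_nat.
  have inL : 0 <= L <= Lm%:R.
    by case/andP: d2 => d2 _; case/andP: in2 => _ in2; rewrite L0; lra.
  have MBd : (M < Bd)%N by rewrite BdE addnS ltnS (leq_trans MMx')// leq_addr.
  have M'Bd : (M' < Bd)%N by rewrite BdE addnS ltnS (leq_trans MMx)// leq_addr.
  have /andP[_ lo] := UT M MBd.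
  have up := UTS M.+1; rewrite -M'E in up; have {}up := up M'Bd.
  have {}lo := le_trans lo (Umono ML).
  have {}up := le_trans (Umono LM) up.
  have eL0 : 0 <= expR (- (alpha * L)) by exact: expR_ge0.
  have {}lo := ler_wpM2r eL0 lo.
  have {}up := ler_wpM2r eL0 up.
  have /andP[yM0 yMA] := yb M MMx'.
  have /andP[yM'0 yM'A] := yb M' MMx.
  have Ty m : T m * expR (- (alpha * L)) = y m * expR (alpha * (w * m%:R - L)).
    by rewrite /y [RHS]mulrAC -expRD [RHS]mulrC; congr (_ * expR _); rewrite /a; ring.
  rewrite !Ty in lo up.
  have lo' : y M - alpha * w * win_apriori N <= U L * expR (- (alpha * L)).
    apply: le_trans lo.
    have h1 : 1 - alpha * w <= expR (alpha * (w * M%:R - L)).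
      apply: le_trans (expR_ge1Dx _); rewrite lerD2l.
      by rewrite lerNl -mulrN opprB ler_pM2l.
    have h2 := ler_wpM2l yM0 h1.
    have aw0 : 0 <= alpha * w by rewrite mulr_ge0 ?ltW.
    have h3 := ler_wpM2l aw0 yMA.
    lra.
  have up' : U L * expR (- (alpha * L)) <= y M' +
      alpha * k.+2%:R * expR (alpha * k.+2%:R) * w * win_apriori N.
    apply: (le_trans up).
    case/andP: d2 => d20 d21; set x := alpha * _.
    have x0 : 0 <= x by rewrite mulr_ge0// ltW.
    have x1 : x <= alpha * k.+2%:R * w by rewrite -mulrA ler_pM2l.
    have x2 : x <= alpha * k.+2%:R.
      by apply: (le_trans x1); rewrite ler_piMr// mulr_ge0// ltW.
    have h1 : expR x - 1 <= alpha * k.+2%:R * expR (alpha * k.+2%:R) * w.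
      apply: (le_trans (expR_sub1 x0)); rewrite [leRHS]mulrAC.
      by apply: ler_pM; rewrite ?expR_ge0// ler_expR.
    have h2 : y M' * (expR x - 1) <= win_apriori N *
        (alpha * k.+2%:R * expR (alpha * k.+2%:R) * w).
      by apply: ler_pM => //; rewrite subr_ge0 -expR0 ler_expR.
    lra.
  have M1r : (M0 <= M <= Mx)%N by rewrite M0M.
  have M2r : (M0 <= M' <= Mx)%N by rewrite MMx (leq_trans M0M).
  have p1 := yp M M1r; have p2 := yp M' M2r.
  have l1 := pl _ _ in1 inL; have l2 := pl _ _ in2 inL.
  have {}l1 : `|p.[w * M%:R] - p.[L]| <= win_lip q N * k.+2%:R * w.
    apply: (le_trans l1); rewrite -mulrA ler_wpM2l// distrC ger0_norm ?subr_ge0//.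
    by apply: (le_trans d1); rewrite ler_peMl ?ler1n// ltW.
  have {}l2 : `|p.[w * M'%:R] - p.[L]| <= win_lip q N * k.+2%:R * w.
    by apply: (le_trans l2); rewrite -mulrA ler_wpM2l//; case/andP: d2 => d20 d21; rewrite ger0_norm.
  move: p1 p2 l1 l2; rewrite !ler_norml => /andP[p11 p12] /andP[p21 p22].
  move=> /andP[l11 l12] /andP[l21 l22].
  have z1 : 0 <= alpha * k.+2%:R * expR (alpha * k.+2%:R) * w * win_apriori N.
    by rewrite !mulr_ge0 ?expR_ge0// ltW.
  have z2 : 0 <= alpha * w * win_apriori N by rewrite !mulr_ge0// ltW.
  rewrite /win_err -/w; apply/andP; split; lra.
have kf : 1 <= k`!%:R :> R by rewrite ler1n fact_gt0.
rewrite pk -mulrBl normrM [X in _ * X]ger0_norm ?invr_ge0//.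
rewrite ler_pdivrMr ?(lt_le_trans ltr01)//.
pose eps := C * Bd%:R ^+ k.+1 * expR (eta - eta * N%:R / k.+1%:R).
have zeps m : (M0 <= m <= M0 + k)%N -> `|z m - cc| <= eps.
  move=> /andP[M0m mM0].
  have mBd : (m < Bd)%N.
    by rewrite BdE (leq_ltn_trans mM0)// addnS ltnS leq_add// leqW.
  apply: (le_trans (zcc m mBd)); apply: ler_pM; rewrite ?mulr_ge0 ?exprn_ge0 ?expR_ge0//.
    by rewrite ler_wpM2l// lerXn2r ?nnegrE// ler_nat.
  rewrite ler_expR; set b := (m %/ k.+1)%N.
  have mb : m%:R <= (b%:R + 1) * k.+1%:R :> R.
    by rewrite natr1 -natrM ler_nat ltnW// ltn_ceil.
  (* Rounding down to [b] costs at most w <= 1, whence the summand [eta] in the exponent of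
     [win_lead]. *)
  have {}mb : N%:R / k.+1%:R <= w * b%:R + 1.
    rewrite ler_pdivrMr// -wM0; apply: (@le_trans _ _ (w * m%:R)).
      by rewrite ler_pM2l// ler_nat.
    apply: (le_trans (ler_wpM2l (ltW w0) mb)); rewrite mulrA ler_wpM2r//.
    by rewrite mulrDr mulr1 lerD2l.
  have := ler_wpM2l (ltW eta0) mb.
  by rewrite -[eta * N%:R / _]mulrA; set r := N%:R / _; lra.
have a0 : 0 <= a by rewrite mulr_ge0// ltW.
have := leading_difference a0 zeps.
have M0kBd : (M0 + k < Bd)%N by rewrite BdE addnS ltnS leq_add// leqW.
rewrite -Tz// -iter_fwd_exp -/a.
rewrite -[iter k fwd _ M0]/(iter k fwd y M0) -[in iter k fwd y M0](addn0 M0) -(iter_fwd_shift _ y) -/y0.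
set d := iter k fwd y0 0%N => dcc.
set x := (1 - expR (- a)) * q%:R.
have aq : a * q%:R = alpha by rewrite /a -mulrA wq mulr1.
have /andP[a1 a2] := one_sub_expR a0.
have x2 : x <= alpha by rewrite -aq ler_pM2r.
have x1 : alpha - alpha ^+ 2 * w <= x.
  have -> : alpha - alpha ^+ 2 * w = (a - a ^+ 2) * q%:R.
    have a2q : a ^+ 2 * q%:R = a * (a * q%:R) by ring.
    by rewrite mulrBl a2q aq /a; ring.
  by rewrite ler_pM2r.
have x0 : 0 <= x.
  by rewrite mulr_ge0// subr_ge0 -expR0 ler_expR oppr_le0.
have -> : d * q%:R ^+ k - cc * alpha ^+ k =
    (d - cc * (1 - expR (- a)) ^+ k) * q%:R ^+ k + cc * (x ^+ k - alpha ^+ k).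
  by rewrite /x exprMn; ring.
apply: (@le_trans _ _ (win_lead q N)); last first.
  have al1 : 0 <= 1 + alpha by rewrite addr_ge0// ltW.
  have w_ge0 : 0 <= w := ltW w0.
  have c_ge0 : 0 <= c := le_trans cc0 ccc.
  rewrite ler_peMr// /win_lead addr_ge0//.
    by rewrite !mulr_ge0 ?exprn_ge0 ?expR_ge0.
  by rewrite !mulr_ge0 ?exprn_ge0// ltW.
apply: (le_trans (ler_normD _ _)); rewrite !normrM (ger0_norm cc0).
rewrite [X in _ * X + _]ger0_norm ?exprn_ge0//.
apply: lerD; first by rewrite ler_wpM2r ?exprn_ge0.
apply: ler_pM => //.
have al1 : 1 <= 1 + alpha by rewrite lerDl ltW.
apply: (le_trans (exprn_lipschitz k al1 _ _)).
- by rewrite x0 (le_trans x2)// lerDr.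
- by rewrite ltW//= lerDr.
apply: ler_wpM2l; first by rewrite !mulr_ge0 ?exprn_ge0// (le_trans ler01).
by rewrite distrC ger0_norm ?subr_ge0// -/w; lra.
Qed.

End WindowScale.

Section GridAsymptotics.
Context {R : realType} {alpha eta C c : R} {k : nat}.
Context (eta0 : 0 < eta) (eta_alpha : eta <= alpha) (C0 : 0 <= C) (c0 : 0 <= c).

Let alpha0 : 0 < alpha. Proof. exact: lt_le_trans eta_alpha. Qed.

Lemma expdec_bound (e : nat -> R) A m b : 0 <= A -> 0 < b ->
  (forall n, e n <= A * (n.+1%:R ^+ m * expR (- (b * n%:R)))) -> expdec e.
Proof.
by move=> A0 b0 eA; apply: expdec_le eA _; apply: expdecZ => //; exact: expdec_poly.
Qed.

(* The mesh [1 / q n] is [expR (- theta * n)], with [theta] so small that the powers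
   of [q n] lost to differencing do not consume the saving [expR (- eta * n)]. *)
Lemma window : exists2 err : nat -> R, expdec err &
  forall U cc, 0 <= cc <= c -> {homo U : x y / x <= y} ->
  grid_approx alpha eta C k cc U -> forall n, exists p : {poly R},
  [/\ (size p <= k.+1)%N,
    forall L, n.+1%:R <= L <= (k.+1 * n.+2)%:R ->
      `|U L * expR (- (alpha * L)) - p.[L]| <= err n &
    `|p`_k - cc * alpha ^+ k / k`!%:R| <= err n].
Proof.
have [CK CK0 CKP] := @coef_bound_scaled R k.
pose K : R := k.+1%:R.
have K0 : 0 < K by rewrite ltr0n.
have K1 : 1 <= K by rewrite ler1n.
(* With q about e^(theta n), Newton's remainder loses q^(2k+2) and the leading coefficient q^(2k+1).
   Both losses stay within e^(2 K theta n), which is half of the saving at rate [eta / K]. *)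
have [theta theta0 thetaK] : exists2 theta : R, 0 < theta & 4 * K * theta = eta / K.
  exists (eta / (4 * K ^+ 2)); first by rewrite divr_gt0// mulr_gt0// exprn_gt0.
  by field; rewrite gt_eqF.
have etaK : eta / K <= eta by rewrite ler_pdivrMr// ler_peMr// ltW.
have etaK0 : 0 < eta / K by rewrite divr_gt0.
pose q n := (Num.truncn (expR (theta * n.+1%:R))).+1.
have E1 n : 1 <= expR (theta * n%:R) by rewrite -expR0 ler_expR mulr_ge0// ltW.
have qV n : (q n)%:R^-1 <= expR (- (theta * n%:R)).
  rewrite expRN lef_pV2 ?posrE ?expR_gt0 ?ltr0n//.
  apply: (le_trans _ (ltW (truncnS_gt _))).
  by rewrite ler_expR ler_pM2l// ler_nat.
pose Q0 := 2 * expR theta.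
have Q00 : 0 <= Q0 by rewrite mulr_ge0 ?expR_ge0.
have qhi n : (q n)%:R <= Q0 * expR (theta * n%:R).
  have -> : Q0 * expR (theta * n%:R) = 2 * expR (theta * n.+1%:R).
    rewrite /Q0 -mulrA -expRD; congr (_ * expR _); rewrite -[n.+1%:R]natr1; ring.
  rewrite /q -natr1; have := E1 n.+1.
  have : (Num.truncn (expR (theta * n.+1%:R)))%:R <= expR (theta * n.+1%:R).
    by rewrite truncn_le expR_ge0.
  lra.
pose t1 : R := (k + k).+3%:R * 2.
have t10 : 0 <= t1 by rewrite mulr_ge0.
have n1 n : 1 <= n.+1%:R :> R by rewrite ler1n.
have topB n : (win_top (k := k) n.+1)%:R <= t1 * n.+1%:R.
  rewrite /win_top natrM /t1 -mulrA ler_wpM2l// -[n.+2%:R]natr1; have := n1 n; lra.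
pose S1 := Q0 * (t1 + k.+2%:R).
have tk0 : 0 <= t1 + k.+2%:R := addr_ge0 t10 (ler0n _ _).
have S10 : 0 <= S1 := mulr_ge0 Q00 tk0.
have t11 : 0 <= 1 + t1 := addr_ge0 ler01 t10.
have sizeB n : (win_size (k := k) (q n) n.+1)%:R <= S1 * n.+1%:R * expR (theta * n%:R).
  rewrite /win_size natrD natrM.
  have q1 : 1 <= (q n)%:R :> R by rewrite ler1n.
  apply: (@le_trans _ _ ((q n)%:R * ((t1 + k.+2%:R) * n.+1%:R))).
    rewrite mulrDl mulrDr lerD//.
      by rewrite ler_wpM2l// (le_trans ler01).
    by rewrite mulrCA ler_peMr// mulr_ege1.
  have h : 0 <= (t1 + k.+2%:R) * n.+1%:R := mulr_ge0 tk0 (ler0n _ _).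
  by have := ler_wpM2r h (qhi n); rewrite /S1; lra.
pose err n := win_err (alpha := alpha) (eta := eta) (C := C) (k := k) (CK := CK) (q n) n.+1
  + win_lead (alpha := alpha) (eta := eta) (C := C) (c := c) (k := k) (q n) n.+1.
pose W n := (win_size (k := k) (q n) n.+1)%:R : R.
have W0 m : 0 <= W m by rewrite /W ler0n.
have WB m n : W n ^+ m <= S1 ^+ m * (n.+1%:R ^+ m * expR (m%:R * theta * n%:R)).
  apply: (@le_trans _ _ ((S1 * n.+1%:R * expR (theta * n%:R)) ^+ m)).
    by apply: lerXn2r (sizeB n); rewrite nnegrE// !mulr_ge0 ?expR_ge0.
  have -> (x y z : R) : (x * y * expR z) ^+ m = x ^+ m * (y ^+ m * expR (m%:R * z)).
    by rewrite !exprMn -expRM_natl mulrA.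
  by rewrite [m%:R * (_ * _)]mulrA.
have newtonD : expdec (fun n => win_newton (eta := eta) (C := C) (k := k) (q n) n.+1).
  pose b := eta - (k.+1 + k.+1)%:R * theta.
  have b0 : 0 < b.
    have -> : b = eta - eta / K / 2 by rewrite /b -thetaK natrD -/K; field.
    by move: etaK etaK0; set r := eta / K; lra.
  apply: (@expdec_bound _ (C * S1 ^+ (k.+1 + k.+1)) (k.+1 + k.+1) b) => //.
    by rewrite mulr_ge0 ?exprn_ge0.
  move=> n; rewrite /win_newton -/(W n).
  have -> : W n ^+ k.+1 * (C * W n ^+ k.+1 * expR (- (eta * n.+1%:R))) =
     C * (W n ^+ (k.+1 + k.+1) * expR (- (eta * n.+1%:R))) by rewrite exprD; ring.
  rewrite -mulrA ler_wpM2l//.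
  apply: (@le_trans _ _ (W n ^+ (k.+1 + k.+1) * expR (- (eta * n%:R)))).
    by rewrite ler_wpM2l ?exprn_ge0// ler_expR lerN2 ler_pM2l// ler_nat.
  apply: (le_trans (ler_wpM2r (expR_ge0 _) (WB _ _))).
  rewrite -!mulrA ler_wpM2l ?exprn_ge0// ler_wpM2l ?exprn_ge0// -expRD ler_expR /b.
  by rewrite le_eqVlt; apply/orP; left; apply/eqP; ring.
have aprB : exists2 A, 0 <= A & forall n, win_apriori (alpha := alpha) (C := C) (k := k) n.+1 <= A * n.+1%:R ^+ k.+1.
  exists (C * (k.+3%:R ^+ k.+1 * expR (alpha * k.+2%:R)) * (1 + t1) ^+ k.+1).
    by rewrite !mulr_ge0 ?exprn_ge0 ?expR_ge0.
  move=> n; rewrite /win_apriori -[leRHS]mulrA -exprMn ler_wpM2l//.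
    by rewrite !mulr_ge0 ?exprn_ge0 ?expR_ge0.
  have h : 0 <= (win_top (k := k) n.+1)%:R :> R by [].
  have h1 := addr_ge0 ler01 h; have h2 := mulr_ge0 t11 (ler0n _ n.+1).
  by rewrite lerXn2r ?nnegrE// mulrDl mul1r lerD.
have lipD : expdec (fun n => win_lip (alpha := alpha) (eta := eta) (C := C) (k := k) (CK := CK) (q n) n.+1
    * k.+2%:R * (q n)%:R^-1).
  have [b b0 [Cn Cn0 newB]] := newtonD; have [A A_ge0 AB] := aprB.
  apply: (@expdec_bound _ (K ^+ 2 * t1 ^+ k * (CK * (A + Cn)) * k.+2%:R) (k + k.+1) theta) => //.
    by rewrite !mulr_ge0 ?exprn_ge0 ?(ltW K0) ?(addr_ge0 A_ge0 Cn0).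
  move=> n; have nk1 : 1 <= n.+1%:R ^+ k.+1 :> R by rewrite exprn_ege1.
  have b1 : win_apriori (alpha := alpha) (C := C) (k := k) n.+1 +
      win_newton (eta := eta) (C := C) (k := k) (q n) n.+1 <= (A + Cn) * n.+1%:R ^+ k.+1.
    rewrite mulrDl lerD//; apply: (le_trans (newB n)); rewrite ler_wpM2l//.
    by apply: le_trans nk1; rewrite -expR0 ler_expR oppr_le0 mulr_ge0// ltW.
  have b2 : (win_top (k := k) n.+1)%:R ^+ k <= t1 ^+ k * n.+1%:R ^+ k.
    by rewrite -exprMn; apply: lerXn2r (topB n); rewrite nnegrE// mulr_ge0.
  have s0 : 0 <= (A + Cn) * n.+1%:R ^+ k.+1.
    by rewrite mulr_ge0 ?exprn_ge0// addr_ge0.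
  rewrite /win_lip -/K exprD.
  apply: (@le_trans _ _ (K ^+ 2 * (t1 ^+ k * n.+1%:R ^+ k) * (CK * ((A + Cn) * n.+1%:R ^+ k.+1))
     * k.+2%:R * expR (- (theta * n%:R)))); last first.
    by rewrite le_eqVlt; apply/orP; left; apply/eqP; ring.
  have pos1 : 0 <= K ^+ 2 * (t1 ^+ k * n.+1%:R ^+ k).
    by rewrite !mulr_ge0 ?exprn_ge0 ?(ltW K0).
  have pos2 : 0 <= K ^+ 2 * (t1 ^+ k * n.+1%:R ^+ k) * (CK * ((A + Cn) * n.+1%:R ^+ k.+1)) * k.+2%:R.
    by apply: mulr_ge0 => //; apply: mulr_ge0 => //; apply: mulr_ge0.
  apply: (@le_trans _ _ (K ^+ 2 * (t1 ^+ k * n.+1%:R ^+ k) * (CK * ((A + Cn) * n.+1%:R ^+ k.+1))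
     * k.+2%:R * (q n)%:R^-1)); last by rewrite ler_wpM2l.
  rewrite ler_wpM2r ?invr_ge0// ler_wpM2r//.
  apply: (@le_trans _ _ (K ^+ 2 * (win_top (k := k) n.+1)%:R ^+ k * (CK * ((A + Cn) * n.+1%:R ^+ k.+1)))).
    rewrite ler_wpM2l ?mulr_ge0 ?exprn_ge0 ?(ltW K0)//.
    by rewrite ler_wpM2l.
  rewrite ler_wpM2r//; first exact: mulr_ge0.
  by rewrite ler_wpM2l// exprn_ge0// ltW.
have aprD (a : R) : 0 <= a -> expdec (fun n => a * (q n)%:R^-1 * win_apriori (alpha := alpha) (C := C) (k := k) n.+1).
  move=> a0; have [A A_ge0 AB] := aprB.
  apply: (@expdec_bound _ (a * A) k.+1 theta) => // [|n]; first exact: mulr_ge0.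
  apply: (@le_trans _ _ (a * (q n)%:R^-1 * (A * n.+1%:R ^+ k.+1))).
    by rewrite ler_wpM2l// mulr_ge0// invr_ge0.
  have := ler_wpM2l (_ : 0 <= a * (A * n.+1%:R ^+ k.+1)) (qV n).
  rewrite !mulr_ge0 ?exprn_ge0// => /(_ isT); lra.
have invD (a : R) : 0 <= a -> expdec (fun n => a * (q n)%:R^-1).
  move=> a0; apply: (@expdec_bound _ a 0 theta) => // n.
  by rewrite expr0 mul1r ler_wpM2l.
pose L1 n := 2 ^+ k * (C * W n ^+ k.+1 * expR (eta - eta * n.+1%:R / K)) * (q n)%:R ^+ k.
have leadD : expdec L1.
  pose b := eta / K - (k + k.+1)%:R * theta.
  have b0 : 0 < b.
    have -> : b = eta / K - eta / K / 2 + theta.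
      by rewrite /b -thetaK natrD -[k.+1%:R]/K (_ : k%:R = K - 1) ?/K -?natr1; field.
    by apply: addr_gt0 => //; move: etaK0; set r := eta / K; lra.
  apply: (@expdec_bound _ (2 ^+ k * (C * S1 ^+ k.+1 * expR eta) * Q0 ^+ k) k.+1 b) => //.
    by rewrite !mulr_ge0 ?exprn_ge0 ?expR_ge0.
  move=> n; rewrite /L1.
  have e1 : expR (eta - eta * n.+1%:R / K) <= expR eta * expR (- (eta / K * n%:R)).
    by rewrite -expRD ler_expR lerD2l lerN2 [leRHS]mulrAC ler_pM2l// ler_nat.
  have e2 : (q n)%:R ^+ k <= Q0 ^+ k * expR (k%:R * theta * n%:R).
    apply: (@le_trans _ _ ((Q0 * expR (theta * n%:R)) ^+ k)).
      by apply: lerXn2r (qhi n); rewrite nnegrE// mulr_ge0 ?expR_ge0.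
    have -> (x y : R) : (x * expR y) ^+ k = x ^+ k * expR (k%:R * y).
      by rewrite exprMn -expRM_natl.
    by rewrite [k%:R * (_ * _)]mulrA.
  have e3 := WB k.+1 n.
  apply: (@le_trans _ _ (2 ^+ k * (C * (S1 ^+ k.+1 * (n.+1%:R ^+ k.+1 * expR (k.+1%:R * theta * n%:R))) *
     (expR eta * expR (- (eta / K * n%:R)))) * (Q0 ^+ k * expR (k%:R * theta * n%:R)))).
    apply: ler_pM => //; rewrite ?mulr_ge0 ?exprn_ge0 ?expR_ge0//.
    rewrite ler_wpM2l ?exprn_ge0//; apply: ler_pM => //.
      by rewrite mulr_ge0 ?exprn_ge0.
    by rewrite ler_wpM2l.
  have -> : expR (- (b * n%:R)) = expR (k.+1%:R * theta * n%:R) *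
      expR (- (eta / K * n%:R)) * expR (k%:R * theta * n%:R).
    rewrite -!expRD; congr expR; rewrite /b natrD; ring.
  by rewrite le_eqVlt; apply/orP; left; apply/eqP; ring.
have pos : 0 <= alpha + alpha * k.+2%:R * expR (alpha * k.+2%:R).
  by rewrite addr_ge0 ?mulr_ge0 ?expR_ge0// ltW.
have posc : 0 <= c * (K ^+ 2 * (1 + alpha) ^+ k * alpha ^+ 2).
  have al1 : 0 <= 1 + alpha := addr_ge0 ler01 (ltW alpha0).
  by rewrite !mulr_ge0 ?exprn_ge0 ?(ltW K0) ?(ltW alpha0).
exists err.
  have D := expdecD (expdecD (expdecD newtonD lipD) (aprD _ pos)) (expdecD leadD (invD _ posc)).
  apply: expdec_le D => n; rewrite /err /win_err /win_lead /L1 /W /K lerD2l lerD2l.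
  by rewrite -!mulrA.
move=> U cc /andP[cc0 ccc] Umono gU n.
have q0 : (0 < q n)%N by [].
have [p [sp pL pk]] := window_scale eta0 eta_alpha C0 cc0 ccc Umono gU CK0 CKP q0 (ltn0Sn n).
have err1 : 0 <= win_err (alpha := alpha) (eta := eta) (C := C) (k := k) (CK := CK) (q n) n.+1.
  apply: le_trans (pL n.+1%:R _); first by [].
  by rewrite lexx ler_nat /= (leq_trans (leqnSn _))// leq_pmull.
have err2 : 0 <= win_lead (alpha := alpha) (eta := eta) (C := C) (c := c) (k := k) (q n) n.+1.
  by apply: le_trans pk.
exists p; split => //.
  by move=> L Lr; apply: (le_trans (pL L Lr)); rewrite /err lerDl.
by apply: (le_trans pk); rewrite /err lerDr.
Qed.

End GridAsymptotics.

(** * Passage to the limit *)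

Section GridLimit.
Context {R : realType} {alpha eta C c : R} {k : nat}.
Context (eta0 : 0 < eta) (eta_alpha : eta <= alpha) (C0 : 0 <= C) (c0 : 0 <= c).

Let alpha0 : 0 < alpha. Proof. exact: lt_le_trans eta_alpha. Qed.

Lemma expdec_eq0 (x A b : R) : 0 < b ->
  (forall n, `|x| <= A * expR (- (b * n%:R))) -> x = 0.
Proof.
move=> b0 xA; apply/eqP/negPn/negP => x0.
have nx0 : 0 < `|x| by rewrite normr_gt0.
pose n := (Num.truncn (A / `|x| / b)).+1.
have := xA n; rewrite expRN ler_pdivlMr ?expR_gt0// => /(le_trans _) h.
have : `|x| * (1 + b * n%:R) <= A by apply: h; rewrite ler_wpM2l// expR_ge1Dx.
have := truncnS_gt (A / `|x| / b); rewrite -/n ltr_pdivrMr// ltr_pdivrMr//.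
move: nx0; set y := `|x|; nra.
Qed.

Lemma grid_asymptotics : exists2 eta', 0 < eta' & exists2 C' : R, 0 <= C' &
  forall U cc, 0 <= cc <= c -> {homo U : x y / x <= y} -> (forall x, 0 <= U x) ->
  grid_approx alpha eta C k cc U ->
  exists2 P : {poly R}, (size P <= k)%N & forall L, 0 <= L ->
    `|U L - expR (alpha * L) * (cc * alpha ^+ k / k`!%:R * L ^+ k + P.[L])|
    <= C' * expR ((alpha - eta') * L).
Proof.
have [err errD win] := window eta0 eta_alpha C0 c0 (k := k).
have [CK CK0 CKP] := @coef_bound_scaled R k.
have [b b0 [Ce Ce0 errB]] := errD.
pose q := expR (- b).
have q01 : 0 < q < 1 by rewrite expR_gt0 -expR0 ltr_expR oppr_lt0.
have qn n : q ^+ n = expR (- (b * n%:R)) by rewrite /q -expRM_natl mulrN mulrC.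
have q1 : 0 < 1 - q by rewrite subr_gt0; case/andP: q01.
pose G1 := CK * (Ce + Ce).
have G10 : 0 <= G1 by rewrite mulr_ge0// addr_ge0.
pose G := G1 / (1 - q).
have G0 : 0 <= G by rewrite divr_ge0// ltW.
have kG0 : 0 <= k.+1%:R * G * 2 ^+ k :=
  mulr_ge0 (mulr_ge0 (ler0n _ _) G0) (exprn_ge0 _ (ler0n _ _)).
have tailD : expdec (fun n => err n + k.+1%:R * G * 2 ^+ k * (n.+1%:R ^+ k * expR (- (b * n%:R)))).
  by apply: expdecD => //; apply: expdecZ => //; exact: expdec_poly.
have [b' b'0 [C3 C30 tailB]] := tailD.
pose Ap := C * (k.+3%:R ^+ k.+1 * expR (alpha * k.+2%:R)) * (1 + k.+1%:R) ^+ k.+1.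
have Ap0 : 0 <= Ap by rewrite /Ap !mulr_ge0 ?exprn_ge0 ?expR_ge0// (addr_ge0 ler01).
pose C4 := Ap + k.+1%:R * (CK * (Ap + Ce) + G).
have C40 : 0 <= C4.
  have h : 0 <= Ap + Ce by exact: addr_ge0.
  by apply: addr_ge0 => //; apply: mulr_ge0 => //; apply: addr_ge0 => //; exact: mulr_ge0.
exists b' => //; exists (C3 * expR (2 * b') + C4 * expR b').
  by rewrite addr_ge0// mulr_ge0 ?expR_ge0.
move=> U cc ccc Umono U0 gU.
have /choice[p pP] := win U cc ccc Umono gU.
have psz n := let: And3 h _ _ := pP n in h.
have pL n := let: And3 _ h _ := pP n in h.
have pk n := let: And3 _ _ h := pP n in h.
have pcauchy n j : `|(p n.+1)`_j - (p n)`_j| <= G1 * q ^+ n.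
  have -> : G1 * q ^+ n = CK * ((Ce + Ce) * q ^+ n) by rewrite mulrA.
  have sz : (size (p n.+1 - p n)%R <= k.+1)%N.
    by rewrite (leq_trans (size_polyD _ _))// geq_max size_polyN !psz.
  rewrite -coefB; apply: (CKP _ _ n.+2 sz) => // i ik.
  (* The multiples of n + 2 up to (k + 1) (n + 2) lie in the windows of both [n] and [n.+1]. *)
  set L := (i.+1 * n.+2)%:R.
  have h1 : `|U L * expR (- (alpha * L)) - (p n).[L]| <= err n.
    apply: pL; rewrite !ler_nat leq_mul// andbT.
    by rewrite (leq_trans (leqnSn _))// leq_pmull.
  have h2 : `|U L * expR (- (alpha * L)) - (p n.+1).[L]| <= err n.+1.
    apply: pL; rewrite !ler_nat leq_pmull//=.
    by rewrite (@leq_trans (k.+1 * n.+2))// leq_mul.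
  rewrite hornerD hornerN; set u := U L * _ in h1 h2.
  have -> : (p n.+1).[L] - (p n).[L] = (u - (p n).[L]) - (u - (p n.+1).[L]) by ring.
  apply: (le_trans (ler_normB _ _)); rewrite mulrDl.
  apply: lerD; [apply: (le_trans h1)|apply: (le_trans h2)].
    by rewrite qn.
  apply: (le_trans (errB _)); rewrite ler_wpM2l// qn ler_expR lerN2.
  by rewrite ler_pM2l// ler_nat.
have /choice[l lP] : forall j, exists l, forall n, `|(p n)`_j - l| <= G * q ^+ n.
  by move=> j; exact: geometric_limit.
have lk : l k = cc * alpha ^+ k / k`!%:R.
  (* For every [n], both sides are exponentially close to the top coefficient of [p n]. *)
  apply/subr0_eq; apply: (@expdec_eq0 _ (G + Ce) b) => // n.
  rewrite -[l k](subrK (p n)`_k) -addrA.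
  apply: (le_trans (ler_normD _ _)); rewrite mulrDl lerD//.
    by rewrite distrC -qn.
  exact: le_trans (pk n) (errB n).
have lim_near n L : 0 <= L -> `|(p n).[L] - \sum_(j < k.+1) l j * L ^+ j|
    <= \sum_(j < k.+1) G * q ^+ n * L ^+ j.
  move=> L0; rewrite (horner_coef_wide _ (psz n)) -sumrB.
  apply: (le_trans (ler_norm_sum _ _ _)); apply: ler_sum => j _.
  rewrite -mulrBl normrM [X in _ * X]ger0_norm ?exprn_ge0//.
  by rewrite ler_wpM2r ?exprn_ge0.
exists (\poly_(j < k) l j); first exact: size_poly.
move=> L L0.
have -> : cc * alpha ^+ k / k`!%:R * L ^+ k + (\poly_(j < k) l j).[L] =
    \sum_(j < k.+1) l j * L ^+ j.
  by rewrite horner_poly big_ord_recr /= lk addrC.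
set S := \sum_(j < k.+1) l j * L ^+ j.
suff main : `|U L * expR (- (alpha * L)) - S| <=
    (C3 * expR (2 * b') + C4 * expR b') * expR (- (b' * L)).
  have -> : U L - expR (alpha * L) * S =
      expR (alpha * L) * (U L * expR (- (alpha * L)) - S).
    by rewrite mulrBr mulrCA -expRD subrr expR0 mulr1.
  rewrite normrM ger0_norm ?expR_ge0// mulrBl expRD mulrCA.
  by rewrite ler_wpM2l// expR_ge0.
have apri x : 0 <= x -> x <= k.+1%:R -> `|U x * expR (- (alpha * x))| <= Ap.
  move=> x0 xk; rewrite ger0_norm ?mulr_ge0 ?expR_ge0//.
  have := ler_wpM2r (expR_ge0 (- (alpha * x))) (grid_apriori (ltW alpha0) C0 Umono gU x0).
  rewrite -[X in _ <= X]mulrA -expRD subrr expR0 mulr1 => /le_trans; apply.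
  have h1 : 0 <= 1 + x := addr_ge0 ler01 x0.
  have h2 : 0 <= 1 + k.+1%:R :> R := addr_ge0 ler01 (ler0n _ _).
  rewrite /Ap ler_wpM2l//; first by rewrite !mulr_ge0 ?exprn_ge0 ?expR_ge0.
  by apply: lerXn2r; rewrite ?nnegrE// lerD2l.
have [L1|L1] := leP 1 L.
  have t1 : (0 < Num.truncn L)%N by rewrite truncn_gt0.
  (* Then n + 1 <= L <= n + 2 lies in window [n], and n >= L - 2 accounts for the factor e^(2
     b'). *)
  pose n := (Num.truncn L).-1.
  have nE : n.+1 = Num.truncn L by rewrite prednK.
  have nL : n.+1%:R <= L by rewrite nE truncn_le.
  have Ln : L <= n.+2%:R by rewrite nE ltW// truncnS_gt.
  have h1 : `|U L * expR (- (alpha * L)) - (p n).[L]| <= err n.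
    by apply: pL; rewrite nL (le_trans Ln)// ler_nat leq_pmull.
  have h2 := lim_near n L L0.
  have h3 : \sum_(j < k.+1) G * q ^+ n * L ^+ j <=
      k.+1%:R * G * 2 ^+ k * (n.+1%:R ^+ k * expR (- (b * n%:R))).
    apply: (@le_trans _ _ (\sum_(j < k.+1) G * q ^+ n * (2 ^+ k * n.+1%:R ^+ k))).
      apply: ler_sum => j _; apply: ler_wpM2l.
        exact: mulr_ge0 G0 (exprn_ge0 _ (expR_ge0 _)).
      rewrite -exprMn; apply: (@le_trans _ _ (L ^+ k)).
        by rewrite ler_weXn2l// -ltnS.
      apply: lerXn2r; rewrite ?nnegrE ?mulr_ge0//.
      have : 1 <= n.+1%:R :> R by rewrite ler1n.
      by move: Ln; rewrite -[n.+2%:R]natr1; lra.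
    rewrite sumr_const card_ord -[X in X <= _]mulr_natl qn.
    by rewrite le_eqVlt; apply/orP; left; apply/eqP; ring.
  rewrite (_ : _ - S = (U L * expR (- (alpha * L)) - (p n).[L]) + ((p n).[L] - S)); last by ring.
  apply: (le_trans (ler_normD _ _)); apply: (le_trans (lerD h1 (le_trans h2 h3))).
  apply: (le_trans (tailB n)).
  rewrite mulrDl -[leLHS]addr0; apply: lerD; last by rewrite !mulr_ge0 ?expR_ge0.
  rewrite -mulrA ler_wpM2l// -expRD ler_expR.
  have := ler_wpM2l (ltW b'0) Ln; rewrite -[n.+2%:R]natr1 -[n.+1%:R]natr1; lra.
(* No window reaches below 1. For [L < 1] all quantities are bounded, and e^(b') makes up for the
   factor e^(-b' L). The limits [l j] are bounded through window 0, at the nodes 1, ..., k + 1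
   covered by [apri]. *)
have lb j : `|l j| <= CK * (Ap + Ce) + G.
  have p0b : `|(p 0%N)`_j| <= CK * (Ap + Ce).
    apply: (CKP _ _ 1%N (psz 0%N)) => // i ik; rewrite muln1.
    have h1 : `|U i.+1%:R * expR (- (alpha * i.+1%:R)) - (p 0%N).[i.+1%:R]| <= err 0%N.
      by apply: pL; rewrite !ler_nat /= muln2 -addnn (leq_trans _ (leq_addr _ _)).
    have h2 := apri i.+1%:R (ler0n _ _); rewrite ler_nat in h2; have {}h2 := h2 ik.
    have h3 := errB 0%N; rewrite mulr0 oppr0 expR0 mulr1 in h3.
    rewrite -[(p 0%N).[_]](subKr (U i.+1%:R * expR (- (alpha * i.+1%:R)))).
    apply: (le_trans (ler_normB _ _)); apply: lerD => //.
    exact: le_trans h1 h3.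
  have := lP j 0%N; rewrite expr0 mulr1 => h.
  rewrite -[l j](subKr (p 0%N)`_j); apply: (le_trans (ler_normB _ _)).
  exact: lerD.
have SB : `|S| <= k.+1%:R * (CK * (Ap + Ce) + G).
  apply: (le_trans (ler_norm_sum _ _ _)).
  apply: (@le_trans _ _ (\sum_(j < k.+1) (CK * (Ap + Ce) + G))).
    apply: ler_sum => j _; rewrite normrM [X in _ * X]ger0_norm ?exprn_ge0//.
    apply: le_trans (lb j); rewrite ler_piMr//.
    by apply: exprn_ile1 => //; exact: ltW.
  by rewrite sumr_const card_ord mulr_natl.
have LB : `|U L * expR (- (alpha * L))| <= Ap.
  by apply: apri => //; apply: (le_trans (ltW L1)); rewrite ler1n.
apply: (le_trans (ler_normB _ _)); apply: (le_trans (lerD LB SB)).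
rewrite -/C4 mulrDl -[leLHS]add0r; apply: lerD; first by rewrite !mulr_ge0 ?expR_ge0.
rewrite -mulrA -[leLHS]mulr1 ler_wpM2l// -expRD -expR0 ler_expR.
by rewrite subr_ge0 ler_piMr// ltW.
Qed.

End GridLimit.

Lemma Upsilon_mono {R : realType} k (h : 'rV[posnat]_k.+1 -> R) :
  (forall x, 0 <= h x) -> {homo Upsilon h : x y / x <= y}.
Proof.
move=> h0 x y xy; set B := (Num.truncn y).+1.
have yB : y <= B%:R by exact/ltW/truncnS_gt.
have sy := hyperbolic_sub_cube (k := k) yB.
have sx := hyperbolic_sub_cube (k := k) (le_trans xy yB).
rewrite /Upsilon !(fsum_seq _ (cube_uniq k.+1 B))//.
rewrite [leLHS]big_mkcond [leRHS]big_mkcond; apply: ler_sum => u _.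
case: ifP => [|_]; last by case: ifP.
by rewrite inE => ux; rewrite ifT// inE; apply: le_trans xy.
Qed.

Theorem theorem2p1 (R : realType) (k : nat) (alpha c D nu delta : R)
    (H : set ('rV[posnat]_k -> R)) (ch : ('rV[posnat]_k -> R) -> R) :
  (2 <= k)%N ->
  0 < alpha -> 0 < c -> 0 < delta -> delta < Num.min 1 alpha ->
  0 < nu <= 1 -> 0 <= D ->
  is_family alpha c D nu delta H ch ->
  exists2 eta : R, 0 < eta & exists C : R,
    forall h, H h ->
    exists2 P : {poly R}, (size P <= k.-1)%N &
    forall N : R, 1 <= N ->
    `| Upsilon h N
       - N `^ alpha * (ch h * alpha ^+ k.-1 / (k.-1)`!%:R * ln N ^+ k.-1
                       + P.[ln N]) |
      <= C * N `^ (alpha - eta).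
Proof.
case: k H ch => // k H ch _ alpha0 c0 delta0 _ /andP[nu0 _] D0 fam.
have [eta eta0 [eta_alpha [C C0 gridP]]] := grid_sequences alpha0 delta0 nu0 D0 fam.
have [eta' eta'0 [C' C'0 asym]] := grid_asymptotics eta0 eta_alpha C0 (ltW c0) (k := k).
exists eta' => //; exists C' => h Hh.
have h0 := family_ge0 fam Hh.
have [|||P sP PP] := asym (fun L => Upsilon h (expR L)) (ch h) (family_ch fam Hh).
- by move=> x y xy; apply: Upsilon_mono => //; rewrite ler_expR.
- by move=> x; exact: sumr_ge0.
- exact: gridP.
exists P => // N N1.
have N0 : 0 < N := lt_le_trans ltr01 N1.
have := PP (ln N) (ln_ge0 N1); rewrite lnK ?posrE//.
by rewrite /powR gt_eqF.
Qed.
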